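(* Let $\mathcal R$ be a commutative unital ring and $k\geqslant 1$. The Magnus expansion $M\colon\mathcal R\mathcal P_k\to A(\mathcal P_k)$ is a universal Vassiliev invariant with coefficients in $\mathcal R$; that is, for every $\mathcal R$-valued finite type invariant $v$ of $\mathcal P_k$ (extended linearly to $v\colon\mathcal R\mathcal P_k\to\mathcal R$) there is a unique $\mathcal R$-linear map $\hat v\colon A(\mathcal P_k)\to\mathcal R$ such that $\hat v\circ M=v$.
   Context: For a group $G$, $JG\subset\mathcal RG$ is the augmentation ideal (the kernel of the homomorphism $\mathcal RG\to\mathcal R$ sending every $g\in G$ to $1$), $J^nG$ is its $n$-th power, $J^0G=\mathcal RG$, $A_n(G)=J^nG/J^{n+1}G$, and $A(G)=\widehat{\bigoplus}_{n\geqslant0}A_n(G)$ is the completion of the direct sum with respect to the grading. Finite type invariants. $\mathcal P_k$ is the pure braid group on $k$ strands. A map $v\colon\mathcal P_k\to\mathcal R$ is of type $n$ if its linear extension to $\mathcal R\mathcal P_k$ vanishes on all singular pure braids with more than $n$ double points, where a double point is identified with (positive crossing) $-$ (negative crossing); equivalently, the linear extension vanishes on $J^{n+1}\mathcal P_k$. It is a finite type (Vassiliev) invariant if it is of type $n$ for some $n$. Combing. The product $\alpha\beta$ of braids means ''$\alpha$ on top of $\beta$''. For $1\leqslant i\leqslant k-1$, $F_i\subset\mathcal P_k$ is the subgroup of pure braids which can be made totally straight apart from the $(i+1)$-st strand, which is allowed to braid around the $i$ strands to its left. It is free on $x_{i+1,j}$, $1\leqslant j\leqslant i$, where in $x_{i+1,j}$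 the $(i+1)$-st strand links once around the $j$-th: in the standard generators $\sigma_1,\dots,\sigma_{k-1}$ of the braid group, $x_{i+1,j}=\sigma_j^{-1}\cdots\sigma_{i-1}^{-1}\sigma_i^2\sigma_{i-1}\cdots\sigma_j$. Every $\beta\in\mathcal P_k$ is uniquely a product $\beta=\beta_{k-1}\cdots\beta_1$ with $\beta_i\in F_i$ (its combed form). Let $\Pi_k=F_{k-1}\times\cdots\times F_1$ (direct product) and let $\mathsf E\colon\mathcal R\mathcal P_k\to\mathcal R\Pi_k$ be the linear extension of $\beta\mapsto(\beta_{k-1},\dots,\beta_1)$. One has $\mathsf E(J^n\mathcal P_k)=J^n\Pi_k$ for all $n\geqslant 0$, so $\mathsf E$ induces an isomorphism of $\mathcal R$-modules $$\widetilde{\mathsf E}\colon A(\mathcal P_k)\to A(\Pi_k)\cong A(F_{k-1})\otimes\cdots\otimes A(F_1)$$ (the tensor product being understood as completed). Magnus expansion. Let $\mathcal R[[X_{i+1,1},\dots,X_{i+1,i}]]$ be the algebra of formal power series in $i$ non-commuting variables. It is identified with $A(F_i)$ by sending $X_{i+1,j}$ to the class of $x_{i+1,j}-1$ in $A_1(F_i)$. The Magnus expansion of the free group is the algebra homomorphism $M\colon\mathcal RF_i\to\mathcal R[[X_{i+1,1},\dots,X_{i+1,i}]]\cong A(F_i)$ with $M(x_{i+1,j})=1+X_{i+1,j}$. The Magnus expansion of pure braids $M\colon\mathcal R\mathcal P_k\to A(\mathcal P_k)$ is the $\mathcal R$-linear map given on a combed braid $\beta=\beta_{k-1}\cdots\beta_1$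 by $$M(\beta)=\widetilde{\mathsf E}^{-1}\bigl(M(\beta_{k-1})\otimes\cdots\otimes M(\beta_1)\bigr).$$
   Formalization: The map v̂ is required to be continuous as well as R-linear (it vanishes on all series without terms of degree ≤ n, for some n); existence and uniqueness are among such maps. Among all R-linear maps on the completion uniqueness fails, e.g. for R a field and k = 2. *)

(* Defs.v *)
From HB Require Import structures.
From mathcomp Require Import all_boot all_algebra perm.
From mathcomp Require Import zify generic_quotient finmap.
From mathcomp Require Import boolp classical_sets functions cardinality fsbigop.

Set Implicit Arguments.
Unset Strict Implicit.
Unset Printing Implicit Defensive.

Import GRing.Theory.

Local Open Scope classical_set_scope.
Local Open Scope ring_scope.
Local Open Scope quotient_scope.

(* A letter (x, true) stands for the generator x, (x, false) for its inverse. *)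
Section PresentedGroup.

Variables (T : choiceType) (rels : seq (T * bool) -> seq (T * bool) -> Prop).

Local Notation word := (seq (T * bool)).

Inductive pres_eq : word -> word -> Prop :=
| pres_rel u v : rels u v -> pres_eq u v
| pres_cancel x b : pres_eq [:: (x, b); (x, ~~ b)] [::]
| pres_refl u : pres_eq u u
| pres_sym u v : pres_eq u v -> pres_eq v u
| pres_trans u v w : pres_eq u v -> pres_eq v w -> pres_eq u w
| pres_cat u u' v v' :
    pres_eq u u' -> pres_eq v v' -> pres_eq (u ++ v) (u' ++ v').

Definition pres_eqb (u v : word) : bool := `[< pres_eq u v >].

Lemma pres_eqb_equiv : equiv_class_of pres_eqb.
Proof.
split=> [u|u v|v u w].
- exact/asboolP/pres_refl.
- by apply/asboolP/asboolP; apply: pres_sym.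
- by move=> /asboolP uv /asboolP vw; apply/asboolP; apply: pres_trans uv vw.
Qed.

Canonical pres_equivrel := EquivRelPack pres_eqb_equiv.
Canonical pres_encModRel := defaultEncModRel pres_eqb.

Definition presented := {eq_quot pres_eqb}.

HB.instance Definition _ : EqQuotient _ pres_eqb presented :=
  EqQuotient.on presented.
HB.instance Definition _ := Choice.on presented.

Definition word_inv (w : word) : word := rev [seq (l.1, ~~ l.2) | l <- w].

Definition pres_class (w : word) : presented := \pi w.

Lemma pres_classP u v : pres_class u = pres_class v <-> pres_eq u v.
Proof.
split; first by move=> /eqP; rewrite /pres_class piE => /asboolP.
by move=> uv; apply/eqP; rewrite /pres_class piE; apply/asboolP.
Qed.

Definition pres_one : presented := pres_class [::].
Definition pres_mul (x y : presented) : presented :=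
  pres_class (repr x ++ repr y).
Definition pres_inv (x : presented) : presented := pres_class (word_inv (repr x)).

Lemma pres_reprK x : pres_class (repr x) = x.
Proof. exact: reprK. Qed.

Lemma pres_eq_repr u : pres_eq (repr (pres_class u)) u.
Proof. by apply/pres_classP; rewrite pres_reprK. Qed.

Lemma word_inv_cat u v : word_inv (u ++ v) = word_inv v ++ word_inv u.
Proof. by rewrite /word_inv map_cat rev_cat. Qed.

Lemma word_mulV w : pres_eq (w ++ word_inv w) [::].
Proof.
elim/last_ind: w => [|w [x b] IH]; first exact: pres_refl.
rewrite -cats1 word_inv_cat catA -(catA w).
apply: pres_trans IH; apply: pres_cat; last exact: pres_refl.
rewrite -[X in pres_eq _ X]cats0; apply: pres_cat; first exact: pres_refl.
exact: pres_cancel.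
Qed.

Lemma word_invK : involutive word_inv.
Proof.
move=> w; rewrite /word_inv map_rev revK -map_comp -[RHS]map_id.
by apply: eq_map => -[x b] /=; rewrite negbK.
Qed.

Lemma pres_mulE u v : pres_mul (pres_class u) (pres_class v) = pres_class (u ++ v).
Proof. by apply/pres_classP; apply: pres_cat; apply: pres_eq_repr. Qed.

Lemma pres_mulA : associative pres_mul.
Proof.
move=> x y z; rewrite -[x]pres_reprK -[y]pres_reprK -[z]pres_reprK.
by rewrite !pres_mulE catA.
Qed.

Lemma pres_mul1g : left_id pres_one pres_mul.
Proof. by move=> x; rewrite -[x]pres_reprK pres_mulE. Qed.

Lemma pres_mulg1 : right_id pres_one pres_mul.
Proof. by move=> x; rewrite -[x]pres_reprK pres_mulE cats0. Qed.

Lemma pres_mulgV : right_inverse pres_one pres_inv pres_mul.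
Proof.
move=> x; rewrite -{1}[x]pres_reprK pres_mulE.
by apply/pres_classP/word_mulV.
Qed.

Lemma pres_mulVg : left_inverse pres_one pres_inv pres_mul.
Proof.
move=> x; rewrite -{2}[x]pres_reprK pres_mulE; apply/pres_classP.
by rewrite -{2}[repr x]word_invK; apply: word_mulV.
Qed.

HB.instance Definition _ := isGroup.Build presented
  pres_mulA pres_mul1g pres_mulg1 pres_mulVg pres_mulgV.

Definition pres_gen (x : T) : presented := pres_class [:: (x, true)].

End PresentedGroup.

Section GeneratedSubgroup.

Local Open Scope group_scope.

Variables (G : groupType) (I : Type) (x : I -> G).

Definition word_eval (s : seq (I * bool)) : G :=
  \prod_(l <- s) (if l.2 then x l.1 else (x l.1)^-1).

Definition generated : {pred G} := fun g => `[< exists s, g = word_eval s >].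

Lemma generated_closed : group_closed generated.
Proof.
split; first by apply/asboolP; exists [::]; rewrite /word_eval big_nil.
move=> _ _ /asboolP[s ->] /asboolP[t ->]; apply/asboolP.
exists (s ++ [seq (l.1, ~~ l.2) | l <- rev t]).
rewrite /word_eval big_cat /=; congr (_ * _); elim: t => [|l t IH].
  by rewrite !big_nil invg1.
rewrite rev_cons -cats1 map_cat big_cat -IH big_cons invgM big_seq1 /=.
by case: l.2; rewrite /= ?invgK.
Qed.

Record gen_subgroup := GenSubgroup {
  gen_subgroup_val :> G; _ : gen_subgroup_val \in generated }.

HB.instance Definition _ := [isSub for gen_subgroup_val].
HB.instance Definition _ := [Choice of gen_subgroup by <:].
HB.instance Definition _ :=
  SubChoice_isSubGroup.Build G generated gen_subgroup generated_closed.

Lemma generated_gen i : x i \in generated.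
Proof. by apply/asboolP; exists [:: (i, true)]; rewrite /word_eval big_seq1. Qed.

Definition subgroup_gen (i : I) : gen_subgroup := GenSubgroup (generated_gen i).

End GeneratedSubgroup.

Section DirectProduct.

Local Open Scope group_scope.

Variables (I : eqType) (G : I -> groupType).

Definition dir_prod := forall i, G i.

HB.instance Definition _ := Choice.copy dir_prod (forall i, G i).

Let dmul (p q : dir_prod) : dir_prod := fun i => p i * q i.
Let dinv (p : dir_prod) : dir_prod := fun i => (p i)^-1.
Let dunit : dir_prod := fun _ => 1.

Let dmulA : associative dmul.
Proof. by move=> p q r; apply: functional_extensionality_dep => i; apply: mulgA. Qed.
Let dmul1g : left_id dunit dmul.
Proof. by move=> p; apply: functional_extensionality_dep => i; apply: mul1g. Qed.
Let dmulg1 : right_id dunit dmul.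
Proof. by move=> p; apply: functional_extensionality_dep => i; apply: mulg1. Qed.
Let dmulVg : left_inverse dunit dinv dmul.
Proof. by move=> p; apply: functional_extensionality_dep => i; apply: mulVg. Qed.
Let dmulgV : right_inverse dunit dinv dmul.
Proof. by move=> p; apply: functional_extensionality_dep => i; apply: mulgV. Qed.

HB.instance Definition _ :=
  isGroup.Build dir_prod dmulA dmul1g dmulg1 dmulVg dmulgV.

Definition dir_inj (i : I) (g : G i) : dir_prod := @dfwith I G (fun=> 1) i g.

End DirectProduct.

Section GroupRing.

Variables (R : comPzRingType) (G : groupType).

Definition finitely_supported : {pred G -> R^o} :=
  fun f => `[< finite_set [set g | f g != 0] >].

Lemma finitely_supported_closed : GRing.subsemimod_closed finitely_supported.
Proof.
split; first split.
- apply/asboolP; apply: sub_finite_set (finite_set0 G) => g /=.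
  by rewrite eqxx.
- move=> f h /asboolP ff /asboolP fh; apply/asboolP.
  have fU : finite_set ([set g | f g != 0] `|` [set g | h g != 0]).
    by rewrite finite_setU.
  apply: sub_finite_set fU => g /=; case: (eqVneq (f g) 0) => [f0|]; last by left.
  case: (eqVneq (h g) 0) => [h0|]; last by right.
  by case/eqP; rewrite [LHS]/(f g + h g) f0 h0; apply: addr0.
- move=> a f /asboolP ff; apply/asboolP; apply: sub_finite_set ff => g /=.
  by apply: contra_neq => f0; rewrite [LHS]/(a *: f g) f0; apply: scaler0.
Qed.

Record group_ring := GroupRing {
  coefs :> G -> R^o; _ : coefs \in finitely_supported }.

HB.instance Definition _ := [isSub for coefs].
HB.instance Definition _ := [Choice of group_ring by <:].
HB.instance Definition _ := GRing.SubChoice_isSubLmodule.Build R (G -> R^o)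
  finitely_supported group_ring finitely_supported_closed.

Lemma gr_of_subproof (g : G) :
  (fun h => (h == g)%:R : R^o) \in finitely_supported.
Proof.
apply/asboolP; apply: sub_finite_set (finite_set1 g) => h /=.
by case: (h =P g) => // _ /eqP.
Qed.

Definition gr_of (g : G) : group_ring := GroupRing (gr_of_subproof g).

(* The R-linear extension of F : G -> V. *)
Definition lin_ext (V : lmodType R) (F : G -> V) (a : group_ring) : V :=
  \sum_(g \in [set: G]) a g *: F g.

Lemma coefsD (a b : group_ring) g : (a + b) g = a g + b g.
Proof. by []. Qed.

Lemma coefsZ c (a : group_ring) g : (c *: a) g = c * a g.
Proof. by []. Qed.

Lemma coefs_sum I (r : seq I) (P : pred I) (a : I -> group_ring) g :
  (\sum_(i <- r | P i) a i) g = \sum_(i <- r | P i) a i g.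
Proof. by elim/big_rec2: _ => //= i y z _ <-. Qed.

Lemma group_ringP (a b : group_ring) : (forall g, a g = b g) -> a = b.
Proof. by move=> ab; apply/val_inj/funext. Qed.

Definition gr_supp (a : group_ring) : {fset G} := fset_set [set g | a g != 0].

Lemma gr_suppP (a : group_ring) g : g \notin gr_supp a -> a g = 0.
Proof.
case: a => a; rewrite /gr_supp /= => af; move: (af) => /asboolP fa.
by rewrite in_fset_set // notin_setE /= => /negP; rewrite negbK => /eqP.
Qed.

Lemma lin_extE (V : lmodType R) (F : G -> V) (A : {fset G}) (a : group_ring) :
  (forall g, g \notin A -> a g = 0) -> lin_ext F a = \sum_(g <- A) a g *: F g.
Proof. by move=> aA; apply: fsbigTE => g /aA ->; rewrite scale0r. Qed.

Lemma lin_ext_linear (V : lmodType R) (F : G -> V) : linear (lin_ext F).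
Proof.
move=> c a b; pose A := (gr_supp a `|` gr_supp b)%fset.
have aA g : g \notin A -> a g = 0.
  by rewrite in_fsetU negb_or => /andP[/gr_suppP].
have bA g : g \notin A -> b g = 0.
  by rewrite in_fsetU negb_or => /andP[_ /gr_suppP].
rewrite (lin_extE F aA) (lin_extE F bA) (@lin_extE _ _ A); last first.
  by move=> g gA; rewrite coefsD coefsZ aA // bA // mulr0 addr0.
rewrite scaler_sumr -big_split; apply: eq_bigr => g _ /=.
by rewrite -[LHS]/((c * a g + b g) *: F g) scalerDl scalerA.
Qed.

HB.instance Definition _ (V : lmodType R) (F : G -> V) :=
  GRing.isLinear.Build R group_ring V _ (lin_ext F) (lin_ext_linear F).

Lemma lin_ext_of (V : lmodType R) (F : G -> V) g : lin_ext F (gr_of g) = F g.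
Proof.
rewrite (@lin_extE _ _ [fset g]%fset) ?big_seq_fset1 /= ?eqxx ?scale1r //.
by move=> h; rewrite in_fset1 /= => /negPf ->.
Qed.

Lemma gr_decomp (a : group_ring) : a = \sum_(g <- gr_supp a) a g *: gr_of g.
Proof.
apply: group_ringP => h; rewrite coefs_sum.
have aE g : (a g *: gr_of g) h = a g * (h == g)%:R by [].
under eq_bigr do rewrite aE.
have [ha|ha] := boolP (h \in gr_supp a).
  rewrite (bigD1_seq h) ?fset_uniq //= eqxx big1 => [|g].
    by rewrite mulr1; apply/esym/addr0.
  by rewrite eq_sym => /negPf ->; apply: mulr0.
rewrite gr_suppP // big_seq big1 // => g ga.
by case: eqP ha => [->|_ _]; [rewrite ga | apply: mulr0].
Qed.

Lemma gr_linear_eq (V : lmodType R) (f h : group_ring -> V) :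
  linear f -> linear h -> (forall g, f (gr_of g) = h (gr_of g)) -> f =1 h.
Proof.
move=> lf lh fh a; rewrite (gr_decomp a).
pose F := GRing.isLinear.Build R group_ring V _ f lf.
pose H := GRing.isLinear.Build R group_ring V _ h lh.
pose f' : {linear group_ring -> V} := HB.pack f F.
pose h' : {linear group_ring -> V} := HB.pack h H.
rewrite -[f]/(f' : _ -> _) -[h]/(h' : _ -> _) !linear_sum.
by apply: eq_bigr => g _; rewrite !linearZ /= fh.
Qed.

Definition gr_mul (a b : group_ring) : group_ring :=
  lin_ext (fun g => lin_ext (fun h => gr_of (g * h)%g) b) a.

Definition gr_one : group_ring := gr_of 1%g.

Lemma gr_mul_of g h : gr_mul (gr_of g) (gr_of h) = gr_of (g * h)%g.
Proof. by rewrite /gr_mul !lin_ext_of. Qed.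

Lemma gr_mul_linearl b : linear (gr_mul^~ b).
Proof. exact: lin_ext_linear. Qed.

Lemma gr_mul_linearr a : linear (gr_mul a).
Proof.
move=> c b b'; rewrite /gr_mul !(lin_extE _ (@gr_suppP a)).
rewrite scaler_sumr -big_split; apply: eq_bigr => g _ /=.
by rewrite linearP scalerDr !scalerA mulrC.
Qed.

Lemma gr_mulDl : left_distributive gr_mul +%R.
Proof.
by move=> a b c; have := gr_mul_linearl c 1 a b; rewrite !scale1r.
Qed.

Lemma gr_mulDr : right_distributive gr_mul +%R.
Proof.
by move=> a b c; have := gr_mul_linearr a 1 b c; rewrite !scale1r.
Qed.

Lemma gr_mulA : associative gr_mul.
Proof.
move=> a b c.
apply: (gr_linear_eq (f := fun a => gr_mul a (gr_mul b c))
  (h := fun a => gr_mul (gr_mul a b) c)) => [||g]; first exact: gr_mul_linearl.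
  by move=> d x y; rewrite !gr_mul_linearl.
apply: (gr_linear_eq (f := fun b => gr_mul (gr_of g) (gr_mul b c))
  (h := fun b => gr_mul (gr_mul (gr_of g) b) c)) => [||h].
- by move=> d x y; rewrite gr_mul_linearl gr_mul_linearr.
- by move=> d x y; rewrite gr_mul_linearr gr_mul_linearl.
apply: (gr_linear_eq (f := fun c => gr_mul (gr_of g) (gr_mul (gr_of h) c))
  (h := fun c => gr_mul (gr_mul (gr_of g) (gr_of h)) c)) => [||k].
- by move=> d x y; rewrite !gr_mul_linearr.
- exact: gr_mul_linearr.
by rewrite !gr_mul_of mulgA.
Qed.

Lemma gr_mul1r : left_id gr_one gr_mul.
Proof.
move=> a; apply: (gr_linear_eq (f := gr_mul gr_one) (h := id)) => [|//|g].
  exact: gr_mul_linearr.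
by rewrite gr_mul_of mul1g.
Qed.

Lemma gr_mulr1 : right_id gr_one gr_mul.
Proof.
move=> a; apply: (gr_linear_eq (f := gr_mul^~ gr_one) (h := id)) => [|//|g].
  exact: gr_mul_linearl.
by rewrite gr_mul_of mulg1.
Qed.

HB.instance Definition _ := GRing.Zmodule_isPzRing.Build group_ring
  gr_mulA gr_mul1r gr_mulr1 gr_mulDl gr_mulDr.

Definition gr_aug : group_ring -> R^o := lin_ext (fun=> 1 : R^o).

(* aug_pow n is J^n, where J = aug_pow 1 is the augmentation ideal. *)
Fixpoint aug_pow (n : nat) : {pred group_ring} :=
  if n is m.+1 then
    fun a => `[< exists2 s : seq (group_ring * group_ring),
      forall p, p \in s -> p.1 \in aug_pow m /\ gr_aug p.2 = 0 &
      a = \sum_(p <- s) p.1 * p.2 >]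
  else predT.

Lemma aug_pow_closed n : GRing.subsemimod_closed (aug_pow n).
Proof.
elim: n => [|n IH]; first by split.
split; first split.
- by apply/asboolP; exists [::]; rewrite ?big_nil.
- move=> _ _ /asboolP[s sP ->] /asboolP[t tP ->]; apply/asboolP.
  exists (s ++ t); last by rewrite big_cat.
  by move=> p; rewrite mem_cat => /orP[/sP|/tP].
- move=> c _ /asboolP[s sP ->]; apply/asboolP.
  exists [seq (c *: p.1, p.2) | p <- s].
    by move=> _ /mapP[p /sP[p1 p2] ->]; split=> //; apply: IH.2.
  rewrite big_map scaler_sumr; apply: eq_bigr => p _.
  exact/esym/(linearZ_LR (lin_ext _)).
Qed.

HB.instance Definition _ n :=
  GRing.isSubmodClosed.Build R group_ring (aug_pow n) (aug_pow_closed n).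

End GroupRing.

Section QuotientModule.

Variables (R : pzRingType) (V : lmodType R) (S : submodClosed V).

Lemma submod_zmod_closed : GRing.zmod_closed (S : {pred V}).
Proof.
split=> [|x y xS yS]; first exact: rpred0.
by rewrite -scaleN1r rpredD ?rpredZ.
Qed.

Definition submod_zmodClosed : zmodClosed V :=
  HB.pack (S : {pred V}) (GRing.isZmodClosed.Build V (S : {pred V}) submod_zmod_closed).

Definition quot_mod := Quotient.quot submod_zmodClosed.

HB.instance Definition _ := GRing.Zmodule.on quot_mod.
HB.instance Definition _ := EqQuotient.on quot_mod.

Definition quot_scale (c : R) (x : quot_mod) : quot_mod := \pi_quot_mod (c *: repr x).

Lemma pi_quot_scale c (x : V) :
  quot_scale c (\pi_quot_mod x) = \pi_quot_mod (c *: x).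
Proof.
have xS : repr (\pi_quot_mod x) - x \in (submod_zmodClosed : {pred V}).
  by rewrite Quotient.idealrBE reprK.
apply/eqP; rewrite -[_ == _]/(_ == _ %[mod Quotient.quot submod_zmodClosed]).
rewrite -Quotient.idealrBE -scalerBr.
exact: (@rpredZ R V S c _ xS).
Qed.

Lemma quot_scaleA a b x : quot_scale a (quot_scale b x) = quot_scale (a * b) x.
Proof.
rewrite -[x]reprK (pi_quot_scale b) (pi_quot_scale a) (pi_quot_scale (a * b)).
by rewrite scalerA.
Qed.

Lemma quot_scale1 : left_id 1 quot_scale.
Proof. by move=> x; rewrite -[x]reprK pi_quot_scale scale1r. Qed.

Lemma quot_scaleDr : right_distributive quot_scale +%R.
Proof.
move=> a x y; rewrite -[x]reprK -[y]reprK.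
have piD (u w : V) : \pi_quot_mod (u + w) = \pi_quot_mod u + \pi_quot_mod w.
  exact: Quotient.pi_add.
by rewrite -piD !pi_quot_scale -piD scalerDr.
Qed.

Lemma quot_scaleDl x : {morph quot_scale^~ x : a b / a + b}.
Proof.
move=> a b; rewrite -[x]reprK !pi_quot_scale scalerDl.
exact: Quotient.pi_add.
Qed.

HB.instance Definition _ := GRing.Zmodule_isLmodule.Build R quot_mod
  quot_scaleA quot_scale1 quot_scaleDr quot_scaleDl.

End QuotientModule.

Section AssociatedGraded.

Variables (R : comPzRingType) (G : groupType).

Section Piece.

Variable n : nat.

Record aug_sub := AugSub {
  aug_val :> group_ring R G; _ : aug_val \in @aug_pow R G n }.

HB.instance Definition _ := [isSub for aug_val].
HB.instance Definition _ := [Choice of aug_sub by <:].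
HB.instance Definition _ := GRing.SubChoice_isSubLmodule.Build R
  (group_ring R G) (@aug_pow R G n) aug_sub (@aug_pow_closed R G n).

Definition aug_sub_next : {pred aug_sub} := fun a => val a \in @aug_pow R G n.+1.

Lemma aug_sub_next_closed : GRing.subsemimod_closed aug_sub_next.
Proof.
have [[S0 SD] SZ] := @aug_pow_closed R G n.+1.
split; first split; first exact: S0.
- by move=> a b; apply: SD.
- by move=> c a; apply: SZ.
Qed.

HB.instance Definition _ :=
  GRing.isSubmodClosed.Build R aug_sub aug_sub_next aug_sub_next_closed.

Definition gr_piece := quot_mod aug_sub_next.

HB.instance Definition _ := GRing.Lmodule.on gr_piece.

(* The class of a in J^n / J^(n+1) when a is in J^n; junk (0) otherwise. *)
Definition piece_class (a : group_ring R G) : gr_piece :=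
  \pi_(quot_mod aug_sub_next) (insubd (0 : aug_sub) a).

Definition piece_repr (c : gr_piece) : group_ring R G :=
  val (repr (c : quot_mod aug_sub_next)).

End Piece.

(* The completed direct sum of the pieces, i.e. their product. *)
Definition graded := forall n, gr_piece n.

HB.instance Definition _ := Choice.copy graded (forall n, gr_piece n).

Let gadd (u w : graded) : graded := fun n => u n + w n.
Let gopp (u : graded) : graded := fun n => - u n.
Let gzero : graded := fun=> 0.
Let gscale (c : R) (u : graded) : graded := fun n => c *: u n.

Let gaddA : associative gadd.
Proof. by move=> u v w; apply: functional_extensionality_dep => n; apply: addrA. Qed.
Let gaddC : commutative gadd.
Proof. by move=> u v; apply: functional_extensionality_dep => n; apply: addrC. Qed.
Let gadd0 : left_id gzero gadd.
Proof. by move=> u; apply: functional_extensionality_dep => n; apply: add0r. Qed.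
Let gaddN : left_inverse gzero gopp gadd.
Proof. by move=> u; apply: functional_extensionality_dep => n; apply: addNr. Qed.

HB.instance Definition _ := GRing.isZmodule.Build graded gaddA gaddC gadd0 gaddN.

Let gscaleA a b u : gscale a (gscale b u) = gscale (a * b) u.
Proof. by apply: functional_extensionality_dep => n; apply: scalerA. Qed.
Let gscale1 : left_id 1 gscale.
Proof. by move=> u; apply: functional_extensionality_dep => n; apply: scale1r. Qed.
Let gscaleDr : right_distributive gscale +%R.
Proof. by move=> a u v; apply: functional_extensionality_dep => n; apply: scalerDr. Qed.
Let gscaleDl u : {morph gscale^~ u : a b / a + b}.
Proof. by move=> a b; apply: functional_extensionality_dep => n; apply: scalerDl. Qed.

HB.instance Definition _ := GRing.Zmodule_isLmodule.Build R graded
  gscaleA gscale1 gscaleDr gscaleDl.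

End AssociatedGraded.

(* Linear functionals that are continuous for the topology of the completion
   and the discrete topology of R; for a linear map this amounts to vanishing
   on all series without terms of degree <= n, for some n. *)
Definition graded_continuous (R : comPzRingType) (G : groupType)
    (f : graded R G -> R^o) : Prop :=
  exists n, forall u : graded R G,
    (forall m, (m <= n)%N -> u m = 0) -> f u = 0.

Section NoncommutativeSeries.

Variables (R : comPzRingType) (I : choiceType).

(* f w is the coefficient of the monomial w in f. *)
Definition nc_series := seq I -> R^o.

HB.instance Definition _ := GRing.Lmodule.copy nc_series (seq I -> R^o).

Definition nc_mul (f g : nc_series) : nc_series :=
  fun w => \sum_(i < (size w).+1) f (take i w) * g (drop i w).
Definition nc_one : nc_series := fun w => (w == [::])%:R.
Definition nc_var (x : I) : nc_series := fun w => (w == [:: x])%:R.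

Let shift (a : I) (f : nc_series) : nc_series := fun w => f (a :: w).

Let nc_mul_nil f g : nc_mul f g [::] = f [::] * g [::].
Proof. by rewrite /nc_mul big_ord_recl big_ord0 addr0. Qed.

Let nc_mul_cons f g a w :
  nc_mul f g (a :: w) = f [::] * g (a :: w) + nc_mul (shift a f) g w.
Proof. by rewrite /nc_mul /= big_ord_recl. Qed.

Let nc_mulDl : left_distributive nc_mul +%R.
Proof.
move=> f g h; apply/funext => w.
rewrite -[RHS]/(nc_mul f h w + nc_mul g h w) /nc_mul -big_split.
by apply: eq_bigr => i _; apply: mulrDl.
Qed.

Let nc_mulDr : right_distributive nc_mul +%R.
Proof.
move=> f g h; apply/funext => w.
rewrite -[RHS]/(nc_mul f g w + nc_mul f h w) /nc_mul -big_split.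
by apply: eq_bigr => i _; apply: mulrDr.
Qed.

Let nc_mulZl (c : R) (f g : nc_series) w :
  nc_mul (fun u => c * f u) g w = c * nc_mul f g w.
Proof.
by rewrite /nc_mul mulr_sumr; apply: eq_bigr => i _; rewrite -mulrA.
Qed.

Let nc_mulA : associative nc_mul.
Proof.
move=> f g h; apply/funext => w; elim: w f g => [|a w IH] f g.
  by rewrite !nc_mul_nil mulrA.
rewrite !nc_mul_cons IH nc_mul_nil mulrDr mulrA -addrA; congr (_ + _).
have -> : shift a (nc_mul f g) =
    (fun u => f [::] * shift a g u) + nc_mul (shift a f) g :> nc_series.
  by apply/funext => u; rewrite {1}/shift nc_mul_cons.
by rewrite nc_mulDl -nc_mulZl.
Qed.

Let nc_mul1 : left_id nc_one nc_mul.
Proof.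
move=> f; apply/funext => -[|a w]; first by rewrite nc_mul_nil mul1r.
rewrite nc_mul_cons mul1r /nc_mul big1 => [|i _]; first exact: addr0.
exact: mul0r.
Qed.

Let nc_mulr1 : right_id nc_one nc_mul.
Proof.
move=> f; apply/funext => w; elim: w f => [|a w IH] f.
  by rewrite nc_mul_nil mulr1.
by rewrite nc_mul_cons IH [X in X + _]mulr0; apply: add0r.
Qed.

HB.instance Definition _ := GRing.Zmodule_isPzRing.Build nc_series
  nc_mulA nc_mul1 nc_mulr1 nc_mulDl nc_mulDr.

End NoncommutativeSeries.

Section Braids.

Local Open Scope group_scope.

Variable k : nat.

(* i : 'I_k.-1 stands for sigma_(i+1), which exchanges the strands in the
   positions i and i+1, counted from 0. *)
Inductive artin_rel : seq ('I_k.-1 * bool) -> seq ('I_k.-1 * bool) -> Prop :=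
| artin_comm (i j : 'I_k.-1) : (i.+1 < j)%N ->
    artin_rel [:: (i, true); (j, true)] [:: (j, true); (i, true)]
| artin_braid (i j : 'I_k.-1) : j = i.+1 :> nat ->
    artin_rel [:: (i, true); (j, true); (i, true)]
              [:: (j, true); (i, true); (j, true)].

Definition braid := presented artin_rel.

HB.instance Definition _ := Group.on braid.

Definition sigma (i : 'I_k.-1) : braid := pres_gen artin_rel i.

Lemma ltn_left (i : 'I_k.-1) : (i < k)%N.
Proof. by apply: leq_trans (ltn_ord i) (leq_pred k). Qed.

Lemma ltn_right (i : 'I_k.-1) : (i.+1 < k)%N.
Proof. by case: (k) i => [[]|n] i //=; rewrite ltnS. Qed.

Definition sigma_perm (i : 'I_k.-1) : 'S_k :=
  tperm (Ordinal (ltn_left i)) (Ordinal (ltn_right i)).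

Definition word_perm (w : seq ('I_k.-1 * bool)) : 'S_k :=
  \prod_(l <- w) sigma_perm l.1.

Definition braid_perm (b : braid) : 'S_k := word_perm (repr b).

Lemma word_perm_cat u v : word_perm (u ++ v) = word_perm u * word_perm v.
Proof. by rewrite /word_perm big_cat. Qed.

Lemma word_perm_eq u v : pres_eq artin_rel u v -> word_perm u = word_perm v.
Proof.
elim=> {u v} [u v []|x b|//|//|u v w _ -> _ -> //|u u' v v' _ uu _ vv].
- move=> i j ij; rewrite /word_perm !big_cons big_nil !mulg1 /=.
  rewrite conjgC {2}/sigma_perm tpermJ !tpermD // -val_eqE /=; lia.
- move=> i j ij; rewrite /word_perm !big_cons big_nil !mulg1 /=.
  have ij1 : Ordinal (ltn_left j) = Ordinal (ltn_right i) by apply: val_inj.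
  pose r := tperm (Ordinal (ltn_left i)) (Ordinal (ltn_right j)).
  have ri : sigma_perm i ^ sigma_perm j = r.
    by rewrite /sigma_perm tpermJ ij1 tpermL tpermD // -val_eqE /=; lia.
  have rj : r ^ sigma_perm i = sigma_perm j.
    by rewrite /r /sigma_perm tpermJ tpermL tpermD ?ij1 // -val_eqE /=; lia.
  by rewrite mulgA [X in X * _ = _]conjgC ri -mulgA (conjgC r) rj.
- by rewrite /word_perm !big_cons big_nil mulg1 /= /sigma_perm tperm2.
- by rewrite !word_perm_cat uu vv.
Qed.

Lemma braid_perm_class w : braid_perm (pres_class artin_rel w) = word_perm w.
Proof. exact/word_perm_eq/pres_eq_repr. Qed.

Lemma braid_permM : {morph braid_perm : b c / b * c}.
Proof.
move=> b c; rewrite -[b]pres_reprK -[c]pres_reprK.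
rewrite -[_ * _]/(pres_mul _ _) pres_mulE !braid_perm_class.
exact: word_perm_cat.
Qed.

Lemma braid_perm1 : braid_perm 1 = 1.
Proof. by rewrite braid_perm_class /word_perm big_nil. Qed.

Lemma braid_permV b : braid_perm b^-1 = (braid_perm b)^-1.
Proof.
by apply: (mulIg (braid_perm b)); rewrite -braid_permM !mulVg braid_perm1.
Qed.

Lemma braid_perm_sigma i : braid_perm (sigma i) = sigma_perm i.
Proof. by rewrite braid_perm_class /word_perm big_seq1. Qed.

Definition is_pure : {pred braid} := fun b => braid_perm b == 1.

Lemma is_pure_closed : group_closed is_pure.
Proof.
split=> [|b c]; rewrite !unfold_in; first by rewrite braid_perm1.
by move=> /eqP bp /eqP cp; rewrite braid_permM braid_permV bp cp divgg.
Qed.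

Record pure_braid := PureBraid {
  pure_val :> braid; _ : pure_val \in is_pure }.

HB.instance Definition _ := [isSub for pure_val].
HB.instance Definition _ := [Choice of pure_braid by <:].
HB.instance Definition _ :=
  SubChoice_isSubGroup.Build braid is_pure pure_braid is_pure_closed.

(* With 0-based indices, this is x_(i+2, j+1) = c^-1 sigma_(i+1)^2 c where
   c = sigma_i ... sigma_(j+1). *)
Definition strand_braid (i : 'I_k.-1) (j : 'I_i.+1) : braid :=
  let c := \prod_(a <- rev (enum 'I_k.-1) | (j <= a < i)%N) sigma a in
  c^-1 * sigma i ^+ 2 * c.

Lemma strand_braid_pure (i : 'I_k.-1) (j : 'I_i.+1) :
  strand_braid j \in is_pure.
Proof.
rewrite unfold_in /strand_braid; set c := \prod_(_ <- _ | _) _.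
rewrite -[sigma i ^+ 2]/(sigma i * sigma i).
rewrite !braid_permM braid_permV braid_perm_sigma.
by rewrite /sigma_perm tperm2 mulg1 mulVg.
Qed.

Definition strand_gen (i : 'I_k.-1) (j : 'I_i.+1) : pure_braid :=
  PureBraid (strand_braid_pure j).

(* i : 'I_k.-1 gives the subgroup F_(i+1). *)
Definition strand_group (i : 'I_k.-1) := gen_subgroup (@strand_gen i).

HB.instance Definition _ i := Group.on (strand_group i).

Definition strand_prod := dir_prod strand_group.

HB.instance Definition _ := Group.on strand_prod.

(* The factors are multiplied in decreasing order of their indices. *)
Definition comb_eval (p : strand_prod) : pure_braid :=
  \prod_(i <- rev (enum 'I_k.-1)) gen_subgroup_val (p i).

(* By the combing theorem there is exactly one such p, so that the default
   value 1 is never used. *)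
Definition comb (b : pure_braid) : strand_prod :=
  xget (1 : strand_prod) [set p | comb_eval p = b].

End Braids.

Section FiniteType.

Variables (R : comPzRingType) (k : nat).

Variant crossing := Positive | Negative | Double.

Definition is_double (c : crossing) : bool := if c is Double then true else false.

(* Singular braids, as products of crossings of adjacent strands. *)
Definition singular_braid := seq ('I_k.-1 * crossing).

Definition double_points (w : singular_braid) : nat :=
  count (fun l => is_double l.2) w.

Definition singular_pure (w : singular_braid) : Prop :=
  (\prod_(l <- w) sigma_perm l.1 = 1)%g.

Definition resolve (w : singular_braid) : group_ring R (braid k) :=
  \prod_(l <- w) match l.2 with
    | Positive => gr_of R (sigma l.1)
    | Negative => gr_of R (sigma l.1)^-1%g
    | Double => gr_of R (sigma l.1) - gr_of R (sigma l.1)^-1%g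
    end.

(* The singular pure braid w is identified with the element of R P_k whose
   image in R B_k is resolve w. *)
Definition of_type (n : nat) (v : pure_braid k -> R) : Prop :=
  forall (w : singular_braid) (a : group_ring R (pure_braid k)),
    singular_pure w -> (n < double_points w)%N ->
    lin_ext (fun b : pure_braid k => gr_of R (b : braid k)) a = resolve w ->
    lin_ext (v : pure_braid k -> R^o) a = 0.

Definition finite_type (v : pure_braid k -> R) : Prop := exists n, of_type n v.

End FiniteType.

Section Magnus.

Variable R : comPzRingType.

(* The identification X_j |-> class of x_j - 1 in A_1. *)
Definition series_to_graded (G : groupType) (m : nat) (x : 'I_m -> G)
    (f : nc_series R 'I_m) : graded R G :=
  fun n => piece_class n
    (\sum_(w : n.-tuple 'I_m) 
      (f w : R) *: (\prod_(j <- w) (gr_of R (x j) - 1) : group_ring R G)).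

(* The algebra homomorphism with M(x_j) = 1 + X_j, which exists and is unique
   when G is free on x. *)
Definition free_magnus (G : groupType) (m : nat) (x : 'I_m -> G) :
    group_ring R G -> nc_series R 'I_m :=
  xget (fun=> 0) [set f : group_ring R G -> nc_series R 'I_m |
    [/\ linear f, GRing.monoid_morphism f &
        forall j, f (gr_of R (x j)) = 1 + nc_var R j]].

(* The image of u_(m-1) (x) ... (x) u_0 under the isomorphism of the completed
   tensor product of the A(G i) with A(G), G the product of the G i: classes
   of a_i in J^(d i) are sent to the class of the product of the a_i, in
   degree the sum of the d i. *)
Definition graded_tensor (m : nat) (G : 'I_m -> groupType)
    (u : forall i, graded R (G i)) : graded R (dir_prod G) :=
  fun n => piece_class n
    (\sum_(d : {ffun 'I_m -> 'I_n.+1} | (\sum_i d i == n)%N)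
      \prod_(i <- rev (enum 'I_m))
        lin_ext (fun g : G i => gr_of R (dir_inj g)) (piece_repr (u i (d i)))).

Variable k : nat.

Local Notation P := (pure_braid k).
Local Notation Pi := (strand_prod k).

Definition comb_ext : group_ring R P -> group_ring R Pi :=
  lin_ext (fun b => gr_of R (comb b)).

(* Independent of the choice of representatives, and bijective, because
   comb_ext maps the n-th power of the augmentation ideal onto that of R Pi. *)
Definition comb_graded (u : graded R P) : graded R Pi :=
  fun n => piece_class n (comb_ext (piece_repr (u n))).

Definition comb_graded_inv (t : graded R Pi) : graded R P :=
  xget 0 [set u | comb_graded u = t].

Definition magnus_braid (b : P) : graded R P :=
  comb_graded_inv (graded_tensor (G := @strand_group k) (fun i =>
    let x := subgroup_gen (@strand_gen k i) in
    series_to_graded x (free_magnus x (gr_of R (comb b i))))).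

Definition magnus : group_ring R P -> graded R P := lin_ext magnus_braid.

End Magnus.

(* Main.v *)
Require Import Defs.
From HB Require Import structures.
From mathcomp Require Import all_boot all_algebra perm.
From mathcomp Require Import zify boolp classical_sets.

(** An element of the [n]-th augmentation power [J^n] of the group ring of pure
    braids has an expansion that starts, in degree [n], with its class in
    [J^n / J^(n+1)] ([magnus_small], [magnus_lead]). Hence the expansion
    truncated in degrees below [n] is injective modulo [J^n] ([magnus_ker]) and
    surjective ([magnus_dense]), and every linear functional that vanishes on
    some [J^n] factors through the expansion in exactly one continuous way
    ([magnus_universal]). A finite type invariant is such a functional
    ([of_type_aug_pow]): pure braids are generated by conjugates of full twists,
    and a full twist minus 1 is a double point up to a crossing, so that [J^n]
    is spanned by singular pure braids with at least [n] double points.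

    For a free group with generators [x_j], the statement on leading terms holds
    because [J^n] is spanned, modulo [J^(n+1)], by the products of [n] factors
    [x_j - 1], whose expansions are monomials ([magnus_part_id]). It extends to
    products of free groups by multilinearity ([braid_part_ext_lead]), and to
    pure braids if the combing map and its inverse preserve augmentation powers.
    This is where the group structure of the pure braids matters: the strand
    groups form an almost direct product, in which [J^n] is spanned by the
    products of elements of [J^(d_i)], one for each strand, with the [d_i]
    adding up to at least [n] ([aug_pow_factor_prod]). Indeed, a pure braid on
    fewer strands conjugates each generator of a strand group into a conjugate
    of itself ([strand_incl_almost_direct]), hence acts trivially on [J / J^2]
    and on all the pieces [J^p / J^(p+1)] of that group ([gr_map_trivial]), so
    that the factors commute up to terms of higher degree.

    The combing theorem is derived from Artin's presentation. Existence is an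
    enumeration of the cosets of the braids that fix the last strand
    ([cascade_decomposition]). Uniqueness, and the freeness of the strand
    groups, come from an action of the braid group on triples [(f, y, j)], where
    [f] is in a group [G], [y] is a sequence in [G], and [j] is the position of
    a marked strand ([comb_act]). When the marked strand returns to its place,
    [f] has been multiplied by the value, on the list [y], of the word that it
    traced around the other strands. This defines homomorphisms from a strand
    group with arbitrary values on the generators ([strand_hom]), and recovers
    the factor of the last strand in a combed braid ([strand_unique]). *)

Set Implicit Arguments.
Unset Strict Implicit.
Unset Printing Implicit Defensive.

Import GRing.Theory.

Local Open Scope ring_scope.
Local Open Scope quotient_scope.

(** * Linear spans *)

Section LinearSpan.

Variables (R : pzRingType) (V : lmodType R).

(** Spans are predicates generated by adding one scaled generator at a time, so
    that a statement about a span is proved by induction on one hypothesis. *)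
Inductive lspan (S : V -> Prop) : V -> Prop :=
| lspan0 : lspan S 0
| lspan_cons c x y : S x -> lspan S y -> lspan S (c *: x + y).

Lemma lspan_in (S : V -> Prop) x : S x -> lspan S x.
Proof. by move=> Sx; rewrite -[x]scale1r -[_ *: x]addr0; do !constructor. Qed.

Lemma lspanD (S : V -> Prop) x y : lspan S x -> lspan S y -> lspan S (x + y).
Proof.
by move=> Sx Sy; elim: Sx => [|c u v Su _ IH]; rewrite ?add0r // -addrA; constructor.
Qed.

Lemma lspanZ (S : V -> Prop) c x : lspan S x -> lspan S (c *: x).
Proof.
elim=> [|d u v Su _ IH]; first by rewrite scaler0; constructor.
by rewrite scalerDr scalerA; constructor.
Qed.

Lemma lspanB (S : V -> Prop) x y : lspan S x -> lspan S y -> lspan S (x - y).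
Proof. by move=> Sx Sy; apply: lspanD => //; rewrite -scaleN1r; apply: lspanZ. Qed.

Lemma lspan_sum (S : V -> Prop) I (r : seq I) (P : pred I) (F : I -> V) :
  (forall i, P i -> lspan S (F i)) -> lspan S (\sum_(i <- r | P i) F i).
Proof. by move=> SF; elim/big_ind: _ => //; [constructor | apply: lspanD]. Qed.

Lemma lspan_least (S T : V -> Prop) x :
  (forall y, S y -> lspan T y) -> lspan S x -> lspan T x.
Proof.
move=> ST; elim=> [|c u v Su _ IH]; first by constructor.
by apply: lspanD => //; apply/lspanZ/ST.
Qed.

Lemma lspan_closed (S : V -> Prop) (T : submodClosed V) x :
  (forall y, S y -> y \in (T : {pred V})) -> lspan S x -> x \in (T : {pred V}).
Proof.
move=> ST; elim=> [|c u v Su _ IH]; first exact: rpred0.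
by apply: rpredD => //; apply/rpredZ/ST.
Qed.

End LinearSpan.

Lemma lspan_image (R : pzRingType) (V W : lmodType R) (S : V -> Prop)
    (T : W -> Prop) (f : V -> W) x :
  linear f -> (forall y, S y -> lspan T (f y)) -> lspan S x -> lspan T (f x).
Proof.
move=> lf ST; elim=> [|c u v Su _ IH]; last by rewrite lf; apply/lspanD/IH/lspanZ/ST.
by have := lf (-1) 0 0; rewrite scaler0 addr0 scaleN1r addNr => ->; constructor.
Qed.

(** * Powers of the augmentation ideal *)

Section AugmentationPowers.

Variables (R : comPzRingType) (G : groupType).
Local Notation RG := (group_ring R G).
Local Notation J n := (@aug_pow R G n).
Implicit Types a b c : RG.

Lemma gr_ofM (g h : G) : gr_of R (g * h)%g = gr_of R g * gr_of R h.
Proof. by rewrite -[RHS]/(gr_mul _ _) gr_mul_of. Qed.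

Lemma gr_of1 : gr_of R (1%g : G) = 1.
Proof. by []. Qed.

Lemma gr_scalerAl t a b : t *: (a * b) = (t *: a) * b.
Proof.
have := gr_mul_linearl b t a 0; rewrite !addr0 => /esym.
by rewrite -[gr_mul 0 b]/(0 * b) mul0r addr0.
Qed.

Lemma gr_scalerAr t a b : t *: (a * b) = a * (t *: b).
Proof.
have := gr_mul_linearr a t b 0; rewrite !addr0 => /esym.
by rewrite -[gr_mul a 0]/(a * 0) mulr0 addr0.
Qed.

Lemma gr_aug_linear : linear (@gr_aug R G : RG -> R^o).
Proof. exact: lin_ext_linear. Qed.

Lemma gr_augM a b : gr_aug (a * b) = (gr_aug a : R) * gr_aug b.
Proof.
apply: (gr_linear_eq (V := R^o) (f := fun a => gr_aug (a * b))
  (h := fun a => (gr_aug a : R) * gr_aug b)) => [t x y|t x y|g].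
- by rewrite mulrDl -gr_scalerAl /gr_aug linearP.
- by rewrite /gr_aug linearP /= mulrDl -mulrA.
apply: (gr_linear_eq (V := R^o) (f := fun b => gr_aug (gr_of R g * b))
  (h := fun b => (gr_aug (gr_of R g) : R) * gr_aug b)) => [t x y|t x y|h].
- by rewrite mulrDr -gr_scalerAr /gr_aug linearP.
- by rewrite /gr_aug linearP /= mulrDr [in LHS]mulrCA.
by rewrite -gr_ofM /gr_aug !lin_ext_of mulr1.
Qed.

Lemma gr_aug_of g : gr_aug (gr_of R (g : G)) = 1.
Proof. by rewrite /gr_aug lin_ext_of. Qed.

Lemma gr_aug_ofB1 (g : G) : gr_aug (gr_of R g - 1) = 0.
Proof. by rewrite /gr_aug linearB /= -gr_of1 !lin_ext_of subrr. Qed.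

Lemma aug_powSM n a b : a \in J n -> gr_aug b = 0 -> a * b \in J n.+1.
Proof.
move=> aJ b0; apply/asboolP; exists [:: (a, b)]; last by rewrite big_seq1.
by move=> p; rewrite inE => /eqP ->.
Qed.

Lemma aug_powS_span n a : a \in J n.+1 ->
  lspan (fun z => exists x y, [/\ x \in J n, gr_aug y = 0 & z = x * y]) a.
Proof.
move=> /asboolP[s sP ->]; rewrite big_seq; apply: lspan_sum => p /sP[p1 p2].
by apply: lspan_in; exists p.1, p.2.
Qed.

Lemma aug_powM p q a b : a \in J p -> b \in J q -> a * b \in J (p + q)%N.
Proof.
elim: q a b => [|q IH] a b aJ.
  rewrite addn0 => _; case: p aJ => // p.
  move/aug_powS_span; elim=> [|t _ y [u [v [uJ v0 ->]]] _ IH].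
    by rewrite mul0r rpred0.
  rewrite mulrDl rpredD // -gr_scalerAl rpredZ // -mulrA.
  by apply: aug_powSM => //; rewrite gr_augM v0 mul0r.
move/aug_powS_span; elim=> [|t _ y [u [v [uJ v0 ->]]] _ IHy].
  by rewrite mulr0 rpred0.
rewrite mulrDr rpredD // -gr_scalerAr rpredZ // mulrA addnS.
by apply: aug_powSM => //; apply: IH.
Qed.

Lemma aug_pow_anti m n a : (m <= n)%N -> a \in J n -> a \in J m.
Proof.
move=> /subnK <-; elim: (n - m)%N a => // d IH a /aug_powS_span aS; apply: IH.
apply: lspan_closed aS => _ [x [y [xJ _ ->]]].
by rewrite -[(d + m)%N]addn0; apply: aug_powM.
Qed.

Lemma aug_pow1 a : (a \in J 1) <-> gr_aug a = 0.
Proof.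
split=> [/aug_powS_span|a0]; last by rewrite -[a]mul1r; apply: aug_powSM.
elim=> [|t _ y [u [v [uJ v0 ->]]] _ IH]; first by rewrite /gr_aug linear0.
by rewrite gr_aug_linear gr_augM v0 IH mulr0 scaler0 addr0.
Qed.

(** The powers are defined by multiplying by the augmentation ideal on the
    right; arguments that move a group element through a product from the left
    need the mirror form. *)
Lemma aug_powS_spanl n a : a \in J n.+1 ->
  lspan (fun z => exists x y, [/\ gr_aug x = 0, y \in J n & z = x * y]) a.
Proof.
elim: n a => [|n IH] a aJ.
  by apply: lspan_in; exists a, 1; rewrite mulr1; split=> //; apply/aug_pow1.
apply: lspan_least (aug_powS_span aJ) => _ [x [y [/IH xS y0 ->]]].
apply: (lspan_image (V := RG) (W := RG) (f := fun x => x * y) _ _ xS)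
  => [t u v|_ [u [v [u0 vJ ->]]]].
  by rewrite mulrDl gr_scalerAl.
by apply: lspan_in; exists u, (v * y); rewrite mulrA; split=> //; apply: aug_powSM.
Qed.

(** A combination of group elements with coefficients of sum zero does not change
    when 1 is subtracted from each of the elements. *)
Lemma aug_ker_span a : gr_aug a = 0 ->
  lspan (fun z => exists g : G, z = gr_of R g - 1) a.
Proof.
move=> a0; have -> : a = lin_ext (fun g => gr_of R g - 1) a.
  transitivity (a - (gr_aug a : R) *: (1 : RG)); first by rewrite a0 scale0r subr0.
  apply: (gr_linear_eq (f := fun a => a - (gr_aug a : R) *: (1 : RG))
    (h := lin_ext (fun g => gr_of R g - 1))) => [t x y|t x y|g].
  - rewrite /gr_aug linearP /= scalerDl -scalerA scalerBr.
    by rewrite opprD addrACA.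
  - by rewrite linearP.
  by rewrite lin_ext_of gr_aug_of scale1r.
rewrite (lin_extE _ (@gr_suppP _ _ a)); apply: lspan_sum => g _.
by apply/lspanZ/lspan_in; exists g.
Qed.

End AugmentationPowers.

Section GroupRingMap.

Variables (R : comPzRingType) (H G : groupType).
Implicit Types (th : H -> G) (a b : group_ring R H).

Definition gr_map th : group_ring R H -> group_ring R G :=
  lin_ext (fun g => gr_of R (th g)).

Lemma gr_map_linear th : linear (gr_map th).
Proof. exact: lin_ext_linear. Qed.

HB.instance Definition _ th :=
  GRing.isLinear.Build R (group_ring R H) (group_ring R G) _ (gr_map th)
    (gr_map_linear th).

Lemma gr_map_of th h : gr_map th (gr_of R h) = gr_of R (th h).
Proof. exact: lin_ext_of. Qed.

Lemma gr_mapM th : {morph th : x y / (x * y)%g} -> {morph gr_map th : a b / a * b}.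
Proof.
move=> thM a b.
apply: (gr_linear_eq (f := fun a => gr_map th (a * b))
  (h := fun a => gr_map th a * gr_map th b)) => [t x y|t x y|g].
- by rewrite mulrDl -gr_scalerAl linearP.
- by rewrite linearP /= mulrDl gr_scalerAl.
apply: (gr_linear_eq (f := fun b => gr_map th (gr_of R g * b))
  (h := fun b => gr_map th (gr_of R g) * gr_map th b)) => [t x y|t x y|h].
- by rewrite mulrDr -gr_scalerAr linearP.
- by rewrite linearP /= mulrDr gr_scalerAr.
by rewrite -gr_ofM !gr_map_of thM gr_ofM.
Qed.

Lemma gr_map1 th : {morph th : x y / (x * y)%g} -> gr_map th 1 = 1.
Proof.
move=> thM; rewrite -gr_of1 gr_map_of; congr gr_of.
by apply: (mulgI (th 1%g)); rewrite -thM !mulg1.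
Qed.

Lemma gr_aug_map th a : gr_aug (gr_map th a) = gr_aug a.
Proof.
apply: (gr_linear_eq (V := R^o) (f := fun a => gr_aug (gr_map th a))
  (h := fun a => gr_aug a)) => [t x y|t x y|g].
- by rewrite linearP /gr_aug linearP.
- by rewrite /gr_aug linearP.
by rewrite gr_map_of !gr_aug_of.
Qed.

Lemma gr_map_pow th n a : {morph th : x y / (x * y)%g} ->
  a \in @aug_pow R H n -> gr_map th a \in @aug_pow R G n.
Proof.
move=> thM; elim: n a => // n IH a /aug_powS_span.
elim=> [|t _ y [u [v [uJ v0 ->]]] _ IHy]; first by rewrite linear0 rpred0.
rewrite gr_map_linear rpredD // rpredZ // gr_mapM //.
by apply: aug_powSM; [apply: IH | rewrite gr_aug_map].
Qed.

End GroupRingMap.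

Section PieceClass.

Variables (R : comPzRingType) (G : groupType) (n : nat).
Local Notation J := (@aug_pow R G).
Implicit Types a b : group_ring R G.

Lemma piece_class_eqP a b : a \in J n -> b \in J n ->
  piece_class n a = piece_class n b <-> a - b \in J n.+1.
Proof.
move=> aJ bJ; rewrite /piece_class; set x := insubd _ a; set y := insubd _ b.
have valB : val (x - y) = a - b by rewrite raddfB /= !insubdK.
rewrite -valB -[val _ \in _]/(x - y \in submod_zmodClosed (@aug_sub_next R G n)).
rewrite Quotient.idealrBE -[_ == _ %[mod _]]/(\pi x == \pi y).
by split=> [->|/eqP].
Qed.

Lemma piece_repr_pow (c : gr_piece R G n) : piece_repr c \in J n.
Proof. by rewrite /piece_repr; case: (repr _). Qed.

Lemma piece_reprK (c : gr_piece R G n) : piece_class n (piece_repr c) = c.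
Proof. by rewrite /piece_class /piece_repr valKd reprK. Qed.

Lemma piece_classD a b : a \in J n -> b \in J n ->
  piece_class n (a + b) = piece_class n a + piece_class n b.
Proof.
move=> aJ bJ; rewrite /piece_class -[RHS]Quotient.pi_add; congr (\pi _).
by apply: val_inj; rewrite /= insubdK ?rpredD //= !insubdK.
Qed.

Lemma piece_classZ (t : R) a : a \in J n ->
  piece_class n (t *: a) = t *: piece_class n a.
Proof.
move=> aJ; rewrite /piece_class -[RHS]/(quot_scale _ _) pi_quot_scale.
by congr (\pi _); apply: val_inj; rewrite /= insubdK ?rpredZ //= !insubdK.
Qed.

Lemma piece_class0 a : a \in J n.+1 -> piece_class n a = 0.
Proof.
move=> aJ; have -> : (0 : gr_piece R G n) = piece_class n 0.
  by rewrite -[0 in RHS](scale0r (0 : group_ring R G)) piece_classZ ?rpred0 // scale0r.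
by apply/piece_class_eqP; rewrite ?rpred0 ?subr0 //; apply: aug_pow_anti aJ.
Qed.

End PieceClass.

(** * Words and generated subgroups *)

Section Generated.

Local Open Scope group_scope.

Variables (G : groupType) (I : Type) (x : I -> G).

Lemma word_eval_cat (u w : seq (I * bool)) :
  word_eval x (u ++ w) = word_eval x u * word_eval x w.
Proof. exact: big_cat. Qed.

Lemma word_eval_cons l (w : seq (I * bool)) :
  word_eval x (l :: w) = (if l.2 then x l.1 else (x l.1)^-1) * word_eval x w.
Proof. exact: big_cons. Qed.

Lemma word_eval_rcons (w : seq (I * bool)) l :
  word_eval x (rcons w l) = word_eval x w * (if l.2 then x l.1 else (x l.1)^-1).
Proof. by rewrite -cats1 word_eval_cat [word_eval x [:: _]]big_seq1. Qed.

Lemma word_eval_nil : word_eval x [::] = 1.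
Proof. exact: big_nil. Qed.

Lemma generated1 : 1 \in generated x.
Proof. exact: (generated_closed x).1. Qed.

Lemma generatedM g h : g \in generated x -> h \in generated x ->
  g * h \in generated x.
Proof. exact: (group_closedM (generated_closed x)). Qed.

Lemma generatedV g : g \in generated x -> g^-1 \in generated x.
Proof. exact: (group_closedV (generated_closed x)). Qed.

Lemma generated_ind (P : G -> Prop) :
  P 1 -> (forall g h, P g -> P h -> P (g * h)) -> (forall g, P g -> P g^-1) ->
  (forall i, P (x i)) -> forall g, g \in generated x -> P g.
Proof.
move=> P1 PM PV Px g /asboolP[w ->]; elim: w => [|[i b] w IH].
  by rewrite word_eval_nil.
by rewrite word_eval_cons; apply: PM IH; case: b => /=; [|apply: PV]; apply: Px.
Qed.

Lemma generated_conj h : (forall i, x i ^ h \in generated x) ->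
  forall g, g \in generated x -> g ^ h \in generated x.
Proof.
move=> xh; apply: generated_ind => // [|g g' gh gh'|g gh].
- by rewrite conj1g generated1.
- by rewrite conjMg generatedM.
- by rewrite conjVg generatedV.
Qed.

End Generated.

Lemma word_eval_inv (I : choiceType) (G : groupType) (x : I -> G) (w : seq (I * bool)) :
  word_eval x (word_inv w) = (word_eval x w)^-1%g.
Proof.
elim: w => [|[i b] w IH]; first by rewrite word_eval_nil invg1.
rewrite /word_inv map_cons rev_cons word_eval_rcons -/(word_inv w) IH.
by rewrite word_eval_cons invgM /=; case: b; rewrite /= ?invgK.
Qed.


(** * Links and cascades *)

Section BraidRelations.

Local Open Scope group_scope.

Variables (G : groupType) (n : nat) (s : nat -> G).

(** Artin's relations among the first [n] values of [s]; the other values are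
    unconstrained. *)
Definition braid_relations :=
  (forall i j, (i.+1 < j < n)%N -> commute (s i) (s j)) /\
  (forall i, (i.+1 < n)%N -> s i * s i.+1 * s i = s i.+1 * s i * s i.+1).

Hypothesis s_rel : braid_relations.

Let commute_conj (x y : G) : commute x y -> x ^ y = x.
Proof. by move=> xy; rewrite conjgE xy mulKg. Qed.

Let commute_of i j : (i.+1 < j < n)%N -> commute (s i) (s j).
Proof. exact: s_rel.1. Qed.

(** The pure braid in which strand [j + d + 1] links once around strand [j].
    Indexing by the distance [d] makes the definition a structural recursion. *)
Fixpoint link d j : G := if d is d'.+1 then link d' j.+1 ^ s j else s j * s j.

Let linkS d j : link d.+1 j = link d j.+1 ^ s j. Proof. by []. Qed.

Lemma link_conj_low d j a : (a.+1 < j)%N -> (j + d < n)%N ->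
  link d j ^ s a = link d j.
Proof.
elim: d j => [|d IH] j aj jn /=.
  by rewrite conjMg commute_conj //; apply/commute_sym/commute_of; lia.
have ja : s j * s a = s a * s j by apply/esym/commute_of; lia.
by rewrite -conjgM ja conjgM IH //; lia.
Qed.

(** The recursion brings the fixed strand next to the moving one; bringing the
    moving strand next to the fixed one gives the same link. *)
Lemma link_shift d j : (j + d.+1 < n)%N ->
  link d.+1 j = link d j ^ (s (j + d).+1)^-1.
Proof.
elim: d j => [|d IH] j jn.
  apply: (canRL (conjgK _)); rewrite addn0 /= -conjgM conjMg.
  have -> : s j.+1 ^ (s j * s j.+1) = s j; last by [].
  apply: (mulgI (s j * s j.+1)); rewrite -conjgC.
  by rewrite s_rel.2 ?mulgA //; lia.
rewrite linkS IH; last by lia.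
have -> : ((j.+1 + d).+1 = (j + d.+1).+1)%N by lia.
rewrite linkS -!conjgM; congr (_ ^ _).
by apply/esym; apply: commuteV; apply: commute_of; lia.
Qed.

Lemma link_conj_mid d j a : (j < a < j + d)%N -> (j + d < n)%N ->
  link d j ^ s a = link d j.
Proof.
elim: d j => [|[|d] IH] j ja jn; try by lia.
case: (ltngtP a j.+1) => [||aj]; first by lia.
  move=> aj; rewrite linkS.
  have sja : s j * s a = s a * s j by apply: commute_of; lia.
  by rewrite -conjgM sja conjgM IH //; lia.
rewrite aj !linkS -!conjgM mulgA -s_rel.2; last by lia.
by rewrite -mulgA [LHS]conjgM link_conj_low //; lia.
Qed.

(** A crossing of the strands [j] and [j + 1] fixes the product of the links
    around them, which is a link around both strands at once. *)
Lemma link_pair_conj d j : (j + d.+1 < n)%N ->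
  (link d.+1 j * link d j.+1) ^ s j = link d.+1 j * link d j.+1.
Proof.
elim: d j => [|d IH] j jn.
  rewrite link_shift // addn0 /=.
  set a := s j; set b := s j.+1.
  have ab : a * b * a = b * a * b by apply: s_rel.2; lia.
  rewrite [(a * a) ^ _]conjgE invgK.
  have -> : b * (a * a * b^-1) * (b * b) = b * a * (a * b).
    by rewrite !mulgA mulgVK.
  apply: (mulgI a); rewrite -conjgC.
  transitivity (b * a * (a * b * a)); first by rewrite !mulgA.
  rewrite ab; transitivity (b * a * b * (a * b)); first by rewrite !mulgA.
  by rewrite -ab !mulgA.
set t := s (j + d.+1).+1.
have tj x : (x ^ t^-1) ^ s j = (x ^ s j) ^ t^-1.
  rewrite -!conjgM; congr (_ ^ _).
  by apply/esym; apply: commuteV; apply: commute_of; lia.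
rewrite link_shift // (link_shift (d := d) (j := j.+1)); last by lia.
have -> : ((j.+1 + d).+1 = (j + d.+1).+1)%N by lia.
rewrite -/t -conjMg tj IH //; lia.
Qed.

Definition link_family i (j : 'I_i.+1) : G := link (i - j) j.

Definition swapn a j := if j == a then a.+1 else if j == a.+1 then a else j.

(** Crossings of the strands to the left of strand [i + 1] act on its links by
    Artin's automorphisms, which permute the free generators up to conjugation. *)
Lemma link_conj_sigma i a e (j : 'I_i.+1) : (a < i)%N -> (i < n)%N ->
  exists2 j' : 'I_i.+1, j' = swapn a j :> nat &
  exists2 g, g \in generated (@link_family i) &
    link_family j ^ (if e then s a else (s a)^-1) = link_family j' ^ g.
Proof.
move=> ai iN; have li := ltn_ord j.
have jaP : (swapn a j < i.+1)%N by rewrite /swapn; do 2?case: eqP; lia.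
exists (Ordinal jaP) => //.
have : Ordinal jaP = swapn a j :> nat by [].
move: (Ordinal jaP) => j' j'E.
have aP : (a < i.+1)%N by lia.
have a1P : (a.+1 < i.+1)%N by lia.
pose d := (i - a.+1)%N.
have Aa : link_family (Ordinal aP) = link d.+1 a.
  by rewrite /link_family (_ : (i - Ordinal aP = d.+1)%N) // /d /=; lia.
have Aa1 : link_family (Ordinal a1P) = link d a.+1 by [].
have Aa1s : link_family (Ordinal a1P) ^ s a = link_family (Ordinal aP).
  by rewrite Aa Aa1.
have pair : (link_family (Ordinal aP) * link_family (Ordinal a1P)) ^ s a =
    link_family (Ordinal aP) * link_family (Ordinal a1P).
  by rewrite Aa Aa1 link_pair_conj //; rewrite /d; lia.
have [ja|ja] := eqVneq (j : nat) a.
  have -> : j' = Ordinal a1P by apply: val_inj; rewrite /= j'E /swapn ja eqxx.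
  have -> : j = Ordinal aP by apply: val_inj.
  case: e.
    exists (link_family (Ordinal aP))^-1; first exact/generatedV/generated_gen.
    move: pair; rewrite conjMg Aa1s => /(canRL (mulgK _)) ->.
    by rewrite conjgE invgK mulgA.
  exists 1; first exact: generated1.
  by rewrite conjg1; apply/esym/(canRL (conjgK _)).
have [ja1|ja1] := eqVneq (j : nat) a.+1.
  have -> : j' = Ordinal aP.
    by apply: val_inj; rewrite /= j'E /swapn ja1 eqxx eqn_leq ltnn.
  have -> : j = Ordinal a1P by apply: val_inj.
  case: e; first by exists 1; [exact: generated1 | rewrite conjg1].
  exists (link_family (Ordinal a1P)); first exact: generated_gen.
  move: pair => /(canRL (conjgK _)) /esym; rewrite conjMg.
  move: Aa1s => /(canRL (conjgK _)) <- H.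
  by apply: (mulgI (link_family (Ordinal a1P))); rewrite H -conjgC.
exists 1; first exact: generated1.
have -> : j' = j.
  by apply: val_inj; rewrite /= j'E /swapn (negPf ja) (negPf ja1).
have fixj : link_family j ^ s a = link_family j.
  rewrite /link_family; case: (ltnP a j) => aj.
    by rewrite link_conj_low //; lia.
  by rewrite link_conj_mid //; lia.
by rewrite conjg1; case: e => //; apply/esym/(canRL (conjgK _)).
Qed.

Definition letters_below i (w : seq (nat * bool)) := all (fun l => l.1 < i)%N w.

(** In particular, a pure braid sends each link to a conjugate of itself. *)
Lemma link_conj_word i w (j : 'I_i.+1) : letters_below i w -> (i < n)%N ->
  exists2 j' : 'I_i.+1, j' = foldl (fun t l => swapn l.1 t) (j : nat) w :> nat &
  exists2 g, g \in generated (@link_family i) &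
    link_family j ^ word_eval s w = link_family j' ^ g.
Proof.
move=> wi iN; elim/last_ind: w wi => [|w [a e] IH].
  by exists j => //; exists 1; rewrite ?generated1 ?word_eval_nil ?conjg1.
rewrite /letters_below all_rcons => /andP[/= ai /IH[j1 j1E [g gF gE]]].
rewrite foldl_rcons -j1E /= word_eval_rcons conjgM gE.
have [j2 j2E [h hF hE]] := link_conj_sigma e j1 ai iN.
exists j2 => //; exists (h * g ^ (if e then s a else (s a)^-1)).
  apply/generatedM/generated_conj => // j'.
  have [j3 _ [h' h'F ->]] := link_conj_sigma e j' ai iN.
  by rewrite /conjg !generatedM ?generatedV ?generated_gen.
by rewrite /= conjJg hE conjgM.
Qed.

Lemma link_family_normal i w g : letters_below i w -> (i < n)%N ->
  g \in generated (@link_family i) ->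
  g ^ word_eval s w \in generated (@link_family i).
Proof.
move=> wi iN; apply: generated_conj => j.
have [j' _ [h hF ->]] := link_conj_word j wi iN.
by rewrite /conjg !generatedM ?generatedV ?generated_gen.
Qed.

(** [cascade d j] moves strand [j + d] to position [j]; such braids represent
    the cosets of the braids on the first [j + d] strands. *)
Fixpoint cascade d j : G := if d is d'.+1 then s (j + d') * cascade d' j else 1.

Lemma cascadeSr d j : cascade d.+1 j = cascade d j.+1 * s j.
Proof.
elim: d j => [|d IH] j; first by rewrite /= addn0 mulg1 mul1g.
by rewrite [LHS]/= -/(cascade d.+1 j) IH mulgA /= addSnnS.
Qed.

Lemma cascade_low d j a : (a.+1 < j)%N -> (j + d <= n)%N ->
  commute (s a) (cascade d j).
Proof.
move=> aj; elim: d => [|d IH] jn; first exact: commute1.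
by apply: commuteM; [apply: commute_of; lia | apply: IH; lia].
Qed.

Lemma cascade_high d j a : (j + d < a < n)%N -> commute (s a) (cascade d j).
Proof.
elim: d => [|d IH] jn; first exact: commute1.
by apply: commuteM; [apply/commute_sym/commute_of; lia | apply: IH; lia].
Qed.

Lemma cascade_mid d j a : (j <= a)%N -> (a.+1 < j + d)%N -> (j + d <= n)%N ->
  cascade d j * s a.+1 = s a * cascade d j.
Proof.
move=> ja; elim: d => [|d IH] ad jn; first by lia.
rewrite /=; case: (ltnP a.+1 (j + d)) => aj.
  rewrite -mulgA IH //; last by lia.
  by rewrite !mulgA; congr (_ * _); apply/esym/commute_of; lia.
case: d IH ad jn aj => [|d] IH ad jn aj; first by lia.
have -> : (j + d.+1 = a.+1)%N by lia.
rewrite /=; have -> : (j + d = a)%N by lia.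
rewrite !mulgA -[_ * s a.+1]mulgA -cascade_high; last by lia.
by rewrite mulgA s_rel.2 //; lia.
Qed.

(** Seen through the cascade, a full twist of the strand that it has moved is a
    link of that strand. *)
Lemma link_cascade d j : (j + d < n)%N ->
  cascade d j.+1 * (s j * s j) = link d j * cascade d j.+1.
Proof.
elim: d => [|d IH] jn; first by rewrite mul1g mulg1.
rewrite link_shift // [cascade _ _]/= -mulgA IH; last by lia.
by rewrite conjgE invgK addSn !mulgA mulgVK.
Qed.

(** Coset enumeration: right multiplication by a generator permutes the cosets
    represented by the cascades, up to a link and a braid on fewer strands. *)
Lemma cascade_decomposition i w : (i < n)%N -> letters_below i.+1 w ->
  exists2 f, f \in generated (@link_family i) &
  exists2 u, letters_below i u &
  exists2 d, (d <= i.+1)%N &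
    word_eval s w = f * word_eval s u * cascade d (i.+1 - d).
Proof.
move=> iN; elim/last_ind: w => [|w [a e] IH].
  exists 1; rewrite ?generated1 //; exists [::] => //; exists 0%N => //.
  by rewrite word_eval_nil !mulg1.
rewrite /letters_below all_rcons => /andP[/= ai /IH[f fF [u ui [d di wE]]]].
rewrite word_eval_rcons wE /=; set sa := if e then _ else _.
pose decomposed x := exists2 f', f' \in generated (@link_family i) &
  exists2 u', letters_below i u' &
  exists2 d', (d' <= i.+1)%N & x = f' * word_eval s u' * cascade d' (i.+1 - d').
have link_step x d' : x \in generated (@link_family i) -> (d' <= i.+1)%N ->
    cascade d (i.+1 - d) * sa = x * cascade d' (i.+1 - d') ->
    decomposed (f * word_eval s u * cascade d (i.+1 - d) * sa).
  (* The link has to pass the braid [u] on fewer strands, which normalises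
     the group of links. *)
  move=> xF d'i E; exists (f * x ^ (word_eval s u)^-1).
    apply: generatedM => //; rewrite -word_eval_inv link_family_normal //.
    by rewrite /letters_below /word_inv all_rev all_map.
  exists u => //; exists d' => //; rewrite -mulgA E.
  by rewrite conjgE invgK !mulgA mulgVK.
have letter_step b : (b < i)%N ->
    cascade d (i.+1 - d) * sa =
      (if e then s b else (s b)^-1) * cascade d (i.+1 - d) ->
    decomposed (f * word_eval s u * cascade d (i.+1 - d) * sa).
  move=> bi E; exists f => //; exists (rcons u (b, e)).
    by rewrite /letters_below all_rcons /= bi.
  by exists d => //; rewrite -mulgA E word_eval_rcons !mulgA.
case: (ltnP a.+1 (i.+1 - d)) => [ad|ja].
  apply: (letter_step a); first by lia.
  rewrite /sa; case: e {sa link_step letter_step}.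
    by apply/esym/cascade_low; lia.
  by apply/commuteV/esym/cascade_low; lia.
set j := (i.+1 - d)%N in letter_step link_step *.
have link1 : 1 \in generated (@link_family i) by apply: generated1.
have jd : (j + d = i.+1)%N by rewrite /j; lia.
have [aj|aj] := eqVneq a.+1 j.
  (* The cascade gets longer; a crossing of the wrong sign differs from the
     right one by a full twist, which becomes a link. *)
  have dE : (i.+1 - d.+1 = a)%N by lia.
  have casc : cascade d.+1 (i.+1 - d.+1) = cascade d j * s a.
    by rewrite cascadeSr dE aj.
  rewrite /sa {letter_step} in link_step *; case: e link_step {sa} => link_step.
    by apply: (link_step 1 d.+1); [| lia | rewrite mul1g casc].
  apply: (link_step (link d a)^-1 d.+1); [| lia |].
    rewrite generatedV //; have aP : (a < i.+1)%N by lia.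
    have := generated_gen (@link_family i) (Ordinal aP).
    by rewrite /link_family /= (_ : i - a = d)%N //; lia.
  apply: (mulgI (link d a)); rewrite mulVKg casc.
  apply: (mulIg (s a)); rewrite -!mulgA mulVg mulg1.
  by rewrite -aj -link_cascade //; lia.
have [aj'|aj'] := eqVneq a j; last first.
  (* The crossing slides through the cascade, which shifts its index. *)
  apply: (letter_step a.-1); first by lia.
  have mid : cascade d j * s a = s a.-1 * cascade d j.
    by rewrite -[in LHS](@ltn_predK j a) ?cascade_mid //; lia.
  rewrite /sa {link_step letter_step sa}; case: e => //.
  by apply: (mulgI (s a.-1)); rewrite mulVKg mulgA -mid mulgK.
(* The cascade ends with a crossing of the strands [j] and [j + 1]: the new one
   either cancels it or makes it a full twist. *)
case: d di wE @j ja jd aj aj' link_step {letter_step}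
  => [|d] di wE j ja jd aj aj' link_step.
  by lia.
have dE : (i.+1 - d = j.+1)%N by lia.
rewrite /sa in link_step *; case: e link_step {sa} => link_step.
  apply: (link_step (link d j) d); [| lia |].
    have jP : (j < i.+1)%N by lia.
    have := generated_gen (@link_family i) (Ordinal jP).
    by rewrite /link_family /= (_ : i - j = d)%N //; lia.
  by rewrite dE aj' cascadeSr -mulgA link_cascade //; lia.
by apply: (link_step 1 d); [| lia | rewrite mul1g dE aj' cascadeSr mulgK].
Qed.

End BraidRelations.

(** * The Hurwitz action and the comb action *)

Section HurwitzAction.

Local Open Scope group_scope.

Variable G : groupType.
Implicit Types (f : G) (y : nat -> G) (a j : nat).

(** Artin's automorphism of a free group, acting on the lists of values of the
    free generators in a group [G]. *)
Definition hurwitz a y : nat -> G := fun t =>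
  if t == a then y a.+1 else if t == a.+1 then y a ^ y a.+1 else y t.

Definition hurwitzV a y : nat -> G := fun t =>
  if t == a then y a.+1 ^ (y a)^-1 else if t == a.+1 then y a else y t.

Lemma hurwitzK a : cancel (hurwitz a) (hurwitzV a).
Proof.
move=> y; apply/funext => t; rewrite /hurwitzV /hurwitz !eqxx.
have -> : (a.+1 == a) = false by lia.
case: eqP => [->|_]; first by rewrite conjgK.
by case: eqP => [->|].
Qed.

Lemma hurwitzVK a : cancel (hurwitzV a) (hurwitz a).
Proof.
move=> y; apply/funext => t; rewrite /hurwitzV /hurwitz !eqxx.
have -> : (a.+1 == a) = false by lia.
case: (t =P a) => [->//|_]; case: eqP => [->|//].
by rewrite conjgE conjgE invgK !mulgA mulVg mul1g mulgVK.
Qed.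

Lemma hurwitz_far a b y : (a.+1 < b)%N ->
  hurwitz a (hurwitz b y) = hurwitz b (hurwitz a y).
Proof.
move=> ab; apply/funext => t; rewrite /hurwitz.
have [e1 e2 e3 e4] : [/\ (a == b) = false, (a == b.+1) = false,
  (a.+1 == b) = false & (a.+1 == b.+1) = false] by split; lia.
have [e5 e6 e7 e8] : [/\ (b == a) = false, (b == a.+1) = false,
  (b.+1 == a) = false & (b.+1 == a.+1) = false] by split; lia.
rewrite e1 e2 e3 e4 e5 e6 e7 e8.
by do ![case: eqP => ? //]; lia.
Qed.

Lemma hurwitz_braid a y :
  hurwitz a (hurwitz a.+1 (hurwitz a y)) =
  hurwitz a.+1 (hurwitz a (hurwitz a.+1 y)).
Proof.
apply/funext => t; rewrite /hurwitz.
have [e1 e2 e3 e4] : [/\ (a.+1 == a) = false, (a.+2 == a) = false,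
  (a.+2 == a.+1) = false & (a == a.+1) = false] by split; lia.
have e5 : (a == a.+2) = false by lia.
have e6 : (a.+1 == a.+2) = false by lia.
rewrite !(e1, e2, e3, e4, e5, e6, eqxx).
case: (t =P a) => [->|ta]; rewrite ?(e1, e2, e3, e4, e5, e6, eqxx) //.
case: (t =P a.+1) => // ta1.
by case: (t =P a.+2) => // _; rewrite conjJg.
Qed.

(** In a state [(f, y, j)], one marked strand is at the position [j]. When a
    generator does not involve it, it braids the other strands, and acts on the
    list [y] of the values in [G] of the loops that the marked strand can make
    around them. A loop consists of two crossings of the same sign, and the
    convention is that its value is charged to the crossing that moves the
    marked strand to the right if the sign is positive, to the left if it is
    negative. This is the action induced from the braids that return the marked
    strand to its place: when it is the last strand, they form the semidirect
    product of a free group and a braid group with one strand less. *)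
Definition comb_state : Type := (G * (nat -> G) * nat)%type.

(** Locked, since unification would otherwise unfold the nested case analyses of
    iterated actions. *)
Fact comb_act_key : unit. Proof. by []. Qed.

Definition comb_act : nat * bool -> comb_state -> comb_state :=
  locked_with comb_act_key (fun l x =>
  let: (f, y, j) := x in let: (a, e) := l in
  if (a.+1 < j)%N then (f, if e then hurwitz a y else hurwitzV a y, j)
  else if a.+1 == j then (if e then f else f * (y a)^-1, y, a)
  else if a == j then (if e then f * y j else f, y, j.+1)
  else (f, if e then hurwitz a.-1 y else hurwitzV a.-1 y, j)).

Lemma comb_actK a e x : comb_act (a, ~~ e) (comb_act (a, e) x) = x.
Proof.
case: x => [[f y] j]; rewrite /comb_act unlock.
case: (ltngtP a.+1 j) => [aj|aj|<-].
- by rewrite aj; case: e; rewrite /= ?hurwitzK ?hurwitzVK.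
- case: eqP => [->|/eqP aNj].
    by rewrite ltnn eqxx; case: e; rewrite /= ?mulgK.
  have -> : (a.+1 < j)%N = false by lia.
  have -> : (a.+1 == j) = false by lia.
  by rewrite (negPf aNj); case: e; rewrite /= ?hurwitzK ?hurwitzVK.
- have -> : (a.+1 < a)%N = false by lia.
  have -> : (a.+1 == a) = false by lia.
  by rewrite eqxx; case: e; rewrite /= ?mulgVK.
Qed.

Lemma comb_act_below a e f y j : (a.+1 < j)%N ->
  comb_act (a, e) (f, y, j) = (f, if e then hurwitz a y else hurwitzV a y, j).
Proof. by rewrite /comb_act unlock => ->. Qed.

Lemma comb_act_above a e f y j : (j < a)%N ->
  comb_act (a, e) (f, y, j) =
  (f, if e then hurwitz a.-1 y else hurwitzV a.-1 y, j).
Proof.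
move=> ja; rewrite /comb_act unlock.
have [-> -> ->] : [/\ (a.+1 < j)%N = false, (a.+1 == j) = false &
  (a == j) = false] by split; lia.
by [].
Qed.

Lemma comb_act_left a e f y :
  comb_act (a, e) (f, y, a.+1) = (if e then f else f * (y a)^-1, y, a).
Proof. by rewrite /comb_act unlock ltnn eqxx. Qed.

Lemma comb_act_right a e f y :
  comb_act (a, e) (f, y, a) = (if e then f * y a else f, y, a.+1).
Proof.
rewrite /comb_act unlock eqxx.
by have [-> ->] : (a.+1 < a)%N = false /\ (a.+1 == a) = false by lia.
Qed.

Lemma hurwitz_id a y t : t <> a -> t <> a.+1 -> hurwitz a y t = y t.
Proof. by move=> /eqP ta /eqP ta1; rewrite /hurwitz (negPf ta) (negPf ta1). Qed.

Lemma comb_act_far a b x : (a.+1 < b)%N ->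
  comb_act (a, true) (comb_act (b, true) x) =
  comb_act (b, true) (comb_act (a, true) x).
Proof.
case: x => [[f y] j] ab; case: (ltngtP j a) => [ja|aj|->].
- rewrite !comb_act_above; try by lia.
  by rewrite hurwitz_far //; lia.
- case: (ltngtP j a.+1) => [|aj1|->]; first by lia.
    case: (ltngtP j b) => [jb|bj|->].
    + rewrite comb_act_above // (@comb_act_below a true _ _ j) //.
      rewrite comb_act_below // comb_act_above // hurwitz_far //; lia.
    + case: (ltngtP j b.+1) => [|bj1|->]; first by lia.
        by rewrite !comb_act_below ?(hurwitz_far _ ab) //; lia.
      rewrite comb_act_left [in RHS]comb_act_below; last by lia.
      by rewrite comb_act_left comb_act_below.
    + rewrite comb_act_right 2?(@comb_act_below a) ?comb_act_right //; last by lia.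
      by rewrite hurwitz_id //; lia.
  rewrite comb_act_above // !comb_act_left comb_act_above //; lia.
- rewrite comb_act_above; last by lia.
  rewrite !comb_act_right comb_act_above; last by lia.
  by rewrite hurwitz_id //; lia.
Qed.

(** When the marked strand starts on the left of both others, the relation holds
    because Artin's automorphisms fix the product of two adjacent loops. *)
Lemma comb_act_braid a x :
  comb_act (a, true) (comb_act (a.+1, true) (comb_act (a, true) x)) =
  comb_act (a.+1, true) (comb_act (a, true) (comb_act (a.+1, true) x)).
Proof.
case: x => [[f y] j]; case: (ltngtP j a) => [ja|aj|->].
- rewrite !comb_act_above; try by lia.
  case: a ja => [|a] ja; first by lia.
  by rewrite /= hurwitz_braid.
- case: (ltngtP j a.+1) => [|aj1|->]; first by lia.
    case: (ltngtP j a.+2) => [|aj2|->]; first by lia.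
      by rewrite !comb_act_below 1?hurwitz_braid //; lia.
    rewrite comb_act_below // !comb_act_left.
    by rewrite comb_act_above.
  rewrite comb_act_left comb_act_above // comb_act_right comb_act_right.
  rewrite comb_act_below // comb_act_left /=.
  by rewrite /hurwitz eqxx.
- rewrite (@comb_act_above a.+1 true _ _ a) // !comb_act_right.
  rewrite comb_act_below //=.
  rewrite -!mulgA /hurwitz !eqxx.
  have -> : (a.+1 == a) = false by lia.
  by rewrite -conjgC.
Qed.

End HurwitzAction.

(** * Presented groups and the braid group *)

Section Presented.

Local Open Scope group_scope.

Variables (T : choiceType) (rels : seq (T * bool) -> seq (T * bool) -> Prop).

Lemma pres_classM u w :
  pres_class rels (u ++ w) = pres_class rels u * pres_class rels w.
Proof. by rewrite -[RHS]/(pres_mul _ _) pres_mulE. Qed.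

Lemma pres_class_eval w : pres_class rels w = word_eval (pres_gen rels) w.
Proof.
elim: w => [|[x b] w IH]; first by rewrite word_eval_nil.
rewrite -cat1s pres_classM IH cat1s word_eval_cons; congr (_ * _).
case: b => //=; apply/esym/mulg1_eq; rewrite -pres_classM.
exact/pres_classP/pres_cancel.
Qed.

Lemma word_eval_pres (G : groupType) (x : T -> G) :
  (forall u w, rels u w -> word_eval x u = word_eval x w) ->
  forall u w, pres_eq rels u w -> word_eval x u = word_eval x w.
Proof.
move=> xrel u w; elim=> {u w} //.
- by move=> t b; rewrite !word_eval_cons word_eval_nil; case: b;
    rewrite /= mulg1 ?mulgV ?mulVg.
- by move=> u v w _ -> _ ->.
- by move=> u u' v v' _ uu' _ vv'; rewrite !word_eval_cat uu' vv'.
Qed.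

End Presented.

Definition free_group (T : choiceType) := presented (fun _ _ : seq (T * bool) => False).

HB.instance Definition _ (T : choiceType) := Group.on (free_group T).

Definition free_gen (T : choiceType) : T -> free_group T := @pres_gen T _.

Section BraidGroup.

Local Open Scope group_scope.

Variable k : nat.
Local Notation B := (braid k).

(** Indexing the generators by all natural numbers, with the default value 1
    beyond the last one, frees the computations from bounded indices. *)
Definition nat_sigma (a : nat) : B := if insub a is Some i then sigma i else 1.

Lemma nat_sigmaE (i : 'I_k.-1) : nat_sigma i = sigma i.
Proof. by rewrite /nat_sigma valK. Qed.

Lemma nat_sigma_relations : braid_relations k.-1 nat_sigma.
Proof.
have rel u w : artin_rel (k := k) u w ->
    word_eval (@sigma k) u = word_eval (@sigma k) w.
  by move=> uw; rewrite -!pres_class_eval; apply/pres_classP/pres_rel.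
split=> [i j /andP[ij jk]|i ik].
  have ik : (i < k.-1)%N by lia.
  have := rel _ _ (@artin_comm k (Ordinal ik) (Ordinal jk) ij).
  by rewrite !word_eval_cons !word_eval_nil /= -!nat_sigmaE /= !mulg1.
have ik' : (i < k.-1)%N by lia.
have := rel _ _ (@artin_braid k (Ordinal ik') (Ordinal ik) erefl).
by rewrite !word_eval_cons !word_eval_nil /= -!nat_sigmaE /= !mulg1 !mulgA.
Qed.

Lemma braid_word (b : B) :
  exists2 w, letters_below k.-1 w & b = word_eval nat_sigma w.
Proof.
exists [seq (val l.1, l.2) | l <- repr b].
  by rewrite /letters_below all_map; apply/allP => -[i e] _ /=.
rewrite -[b in LHS]pres_reprK pres_class_eval.
elim: (repr b) => [|[i e] w IH]; first by rewrite !word_eval_nil.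
by rewrite !word_eval_cons IH /= nat_sigmaE.
Qed.

Lemma nat_sigma_permE a (t : 'I_k) : (a < k.-1)%N ->
  braid_perm (nat_sigma a) t = swapn a t :> nat.
Proof.
move=> ak; have -> : a = Ordinal ak by [].
rewrite nat_sigmaE braid_perm_sigma /sigma_perm /swapn /=.
case: tpermP => [->|->|ta ta1] /=; first by rewrite eqxx.
  by rewrite eqxx (_ : (a.+1 == a) = false) //; lia.
case: eqP => [ta'|_]; first by case: ta; apply: val_inj.
by case: eqP => [ta'|//]; case: ta1; apply: val_inj.
Qed.

Lemma word_permE w (t : 'I_k) : letters_below k.-1 w ->
  braid_perm (word_eval nat_sigma w) t =
    foldl (fun t l => swapn l.1 t) (t : nat) w :> nat.
Proof.
elim: w t => [|[a e] w IH] t; first by rewrite word_eval_nil braid_perm1 perm1.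
move=> /andP[/= ak wk]; rewrite word_eval_cons braid_permM permM IH //=.
congr foldl; case: e => /=; first exact: nat_sigma_permE.
rewrite braid_permV (_ : _^-1 = braid_perm (nat_sigma a)) ?nat_sigma_permE //.
apply: mulg1_eq; have -> : a = Ordinal ak by [].
by rewrite nat_sigmaE braid_perm_sigma /sigma_perm tperm2.
Qed.

Lemma letters_below_leq m n w : (m <= n)%N -> letters_below m w -> letters_below n w.
Proof. by move=> mn; apply: sub_all => l /leq_trans; apply. Qed.

Lemma link_cascadeE d j :
  link nat_sigma d j = (nat_sigma (j + d) * nat_sigma (j + d)) ^ cascade nat_sigma d j.
Proof.
elim: d j => [|d IH] j; first by rewrite /= addn0 conjg1.
by rewrite cascadeSr conjgM addnS -addSn -IH.
Qed.

Lemma prod_iota_cascade (s : nat -> B) m i j :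
  \prod_(a <- rev (iota 0 m) | (j <= a < i)%N) s a = cascade s (minn m i - j) j.
Proof.
elim: m => [|m IH]; first by rewrite big_nil min0n.
rewrite -addn1 iotaD rev_cat big_cons IH add0n addn1.
case: ifP => [/andP[jm mi]|jmi].
  have -> : (minn m i - j = m - j)%N by lia.
  have -> : (minn m.+1 i - j = (m - j).+1)%N by lia.
  by rewrite /= subnKC.
by congr cascade; lia.
Qed.

Lemma strand_braidE (i : 'I_k.-1) (j : 'I_i.+1) :
  strand_braid j = link_family nat_sigma j.
Proof.
rewrite /strand_braid /link_family link_cascadeE.
have -> : \prod_(a <- rev (enum 'I_k.-1) | (j <= a < i)%N) sigma a =
    cascade nat_sigma (i - j) j.
  transitivity (\prod_(a <- map val (rev (enum 'I_k.-1)) | (j <= a < i)%N) nat_sigma a).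
    by rewrite big_map; apply: eq_bigr => a _; rewrite nat_sigmaE.
  rewrite map_rev val_enum_ord prod_iota_cascade; congr cascade.
  by have := ltn_ord i; lia.
rewrite conjgE -mulgA subnKC ?nat_sigmaE //.
by rewrite -ltnS.
Qed.

End BraidGroup.

(** * Freeness of the strand groups *)

Section BraidAction.

Local Open Scope group_scope.

Variables (k : nat) (G : groupType).
Local Notation B := (braid k).
Local Notation s := (@nat_sigma k).
Implicit Types (x : comb_state G) (y : nat -> G) (f : G).

Definition word_act (w : seq (nat * bool)) x := foldl (fun x l => comb_act l x) x w.

Definition nat_word (w : seq ('I_k.-1 * bool)) := [seq (val l.1, l.2) | l <- w].

Definition braid_act (b : B) x := word_act (nat_word (repr b)) x.

Lemma word_act_cat u w x : word_act (u ++ w) x = word_act w (word_act u x).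
Proof. exact: foldl_cat. Qed.

Lemma word_act_pres u w : pres_eq (@artin_rel k) u w ->
  forall x, word_act (nat_word u) x = word_act (nat_word w) x.
Proof.
elim=> {u w} //.
- move=> _ _ [i j ij|i j ji] x /=; first by rewrite -comb_act_far.
  by rewrite ji comb_act_braid.
- by move=> a e x; rewrite /= comb_actK.
- by move=> u v w _ IH _ IH' x; rewrite IH IH'.
by move=> u u' v v' _ IH _ IH' x; rewrite /nat_word !map_cat !word_act_cat IH IH'.
Qed.

Lemma braid_act_class w x : braid_act (pres_class _ w) x = word_act (nat_word w) x.
Proof. exact/word_act_pres/pres_eq_repr. Qed.

Lemma braid_actM b c x : braid_act (b * c) x = braid_act c (braid_act b x).
Proof.
rewrite -[b in LHS]pres_reprK -[c in LHS]pres_reprK -pres_classM braid_act_class.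
by rewrite /nat_word map_cat word_act_cat.
Qed.

Lemma braid_act1 x : braid_act 1 x = x.
Proof. exact: braid_act_class. Qed.

Lemma braid_actK b x : braid_act b^-1 (braid_act b x) = x.
Proof. by rewrite -braid_actM mulgV braid_act1. Qed.

Lemma braid_act_sigma a e x : (a < k.-1)%N ->
  braid_act (if e then s a else (s a)^-1) x = comb_act (a, e) x.
Proof.
move=> ak.
have sE z : braid_act (s a) z = comb_act (a, true) z.
  by have -> : a = Ordinal ak by []; rewrite nat_sigmaE braid_act_class.
case: e; first exact: sE.
by rewrite -{1}[x](comb_actK a false) -sE braid_actK.
Qed.

Lemma braid_act_below i w f y : (i < k.-1)%N -> letters_below i w ->
  exists y', braid_act (word_eval s w) (f, y, i.+1) = (f, y', i.+1).
Proof.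
move=> ik; elim: w y => [|[a e] w IH] y.
  by exists y; rewrite word_eval_nil braid_act1.
move=> /andP[/= ai wi]; rewrite word_eval_cons braid_actM braid_act_sigma.
  by rewrite comb_act_below //; apply: IH.
exact: ltn_trans ai ik.
Qed.

Lemma braid_act_link d j f y : (j + d < k.-1)%N ->
  braid_act (link s d j) (f, y, (j + d).+1) = (f * y j, y, (j + d).+1).
Proof.
elim: d j f y => [|d IH] j f y jk.
  rewrite addn0 in jk *; rewrite braid_actM.
  by rewrite !(braid_act_sigma true) // comb_act_left comb_act_right.
rewrite /= conjgE !braid_actM (braid_act_sigma false); last by lia.
rewrite comb_act_below; last by lia.
rewrite -addSnnS IH; last by lia.
rewrite (braid_act_sigma true) ?comb_act_below; try by lia.
by rewrite hurwitzVK /hurwitzV eqxx (_ : (j.+1 == j) = false) //; lia.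
Qed.

Lemma braid_act_link_family (i : 'I_k.-1) (j : 'I_i.+1) f y :
  braid_act (link_family s j) (f, y, i.+1) = (f * y j, y, i.+1).
Proof.
have := @braid_act_link (i - j) j f y; rewrite subnKC; last by rewrite -ltnS.
exact.
Qed.

(** The multiplier [h] depends on [g] and [y] only, so that it is multiplicative
    in [g]. *)
Lemma braid_act_strand (i : 'I_k.-1) y g :
  g \in generated (@link_family _ s i) ->
  exists h, forall f, braid_act g (f, y, i.+1) = (f * h, y, i.+1).
Proof.
move: g; apply: generated_ind => [|g g' [h hE] [h' h'E]|g [h hE]|j].
- by exists 1 => f; rewrite braid_act1 mulg1.
- by exists (h * h') => f; rewrite braid_actM hE h'E mulgA.
- exists h^-1 => f; apply: (can_inj (braid_actK g)).
  by rewrite -braid_actM mulVg braid_act1 hE mulgVK.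
by exists (y j) => f; apply: braid_act_link_family.
Qed.

End BraidAction.

Section StrandGroups.

Local Open Scope group_scope.

Variable k : nat.
Local Notation s := (@nat_sigma k).

Definition strand_val (i : 'I_k.-1) (g : strand_group i) : braid k :=
  pure_val (gen_subgroup_val g).

Lemma strand_valM i : {morph @strand_val i : g h / g * h}.
Proof. by []. Qed.

Lemma strand_val_inj i : injective (@strand_val i).
Proof. by move=> g h /val_inj/val_inj. Qed.

Lemma strand_val_generated i (g : strand_group i) :
  strand_val g \in generated (@link_family _ s i).
Proof.
rewrite /strand_val; case: g => g /= gP; move: g gP; apply: generated_ind.
- exact: generated1.
- by move=> g h; apply: generatedM.
- by move=> g; apply: generatedV.
by move=> j; rewrite /= strand_braidE; apply: generated_gen.
Qed.

Lemma generated_strand_val (i : 'I_k.-1) g : g \in generated (@link_family _ s i) ->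
  exists h : strand_group i, strand_val h = g.
Proof.
move: g; apply: generated_ind => [|_ _ [g <-] [h <-]|_ [g <-]|j].
- by exists 1.
- by exists (g * h).
- by exists g^-1.
by exists (subgroup_gen (@strand_gen k i) j); rewrite /strand_val /= strand_braidE.
Qed.

(** Freeness, as a universal property: acting on the state [(1, y, i + 1)] and
    taking the first component computes the homomorphism with the prescribed
    values [y]. A braid on fewer strands leaves that component alone, so that
    the value can be read off a combed braid as well. *)
Lemma strand_hom (i : 'I_k.-1) (G : groupType) (y : 'I_i.+1 -> G) :
  exists2 phi : strand_group i -> G, {morph phi : g h / g * h} &
    [/\ forall j, phi (subgroup_gen (@strand_gen k i) j) = y j &
     forall g h u w, letters_below i u -> letters_below i w ->
       strand_val g * word_eval s u = strand_val h * word_eval s w ->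
       phi g = phi h].
Proof.
pose yn t := y (inord t).
have /choice[phi phiE] : forall g : strand_group i, exists h, forall f,
    braid_act (strand_val g) (f, yn, i.+1) = (f * h, yn, i.+1).
  by move=> g; apply/braid_act_strand/strand_val_generated.
exists phi => [g h|].
  have := phiE (g * h) 1; rewrite strand_valM braid_actM !phiE !mul1g.
  by case.
split=> [j|g h u w ui wi]; last first.
  move=> /(congr1 (fun b => (braid_act b (1, yn, i.+1)).1.1)).
  rewrite !braid_actM !phiE !mul1g.
  have [y' ->] := braid_act_below (phi g) yn (ltn_ord i) ui.
  by have [y'' ->] := braid_act_below (phi h) yn (ltn_ord i) wi.
have := phiE (subgroup_gen (@strand_gen k i) j) 1.
rewrite /strand_val /= strand_braidE braid_act_link_family !mul1g.
by case=> <-; rewrite /yn inord_val.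
Qed.

Lemma strand_val_word i (g : strand_group i) :
  exists w, g = word_eval (subgroup_gen (@strand_gen k i)) w.
Proof.
case: g => g gP; have /asboolP[w gE] := gP; exists w; apply: val_inj; rewrite /= gE.
elim: w {g gP gE} => [|[j e] w IH]; first by rewrite !word_eval_nil.
by rewrite !word_eval_cons IH; case: e.
Qed.

(** Taking the free group itself for the target makes the homomorphism
    injective: a word with trivial image is trivial in every group. *)
Lemma strand_unique (i : 'I_k.-1) (g h : strand_group i) u w :
  letters_below i u -> letters_below i w ->
  strand_val g * word_eval s u = strand_val h * word_eval s w -> g = h.
Proof.
move=> ui wi E.
have [phi phiM [phi_gen /(_ g h u w ui wi E) phi_gh]] :=
  strand_hom (@free_gen 'I_i.+1).
have phi_word v : phi (word_eval (subgroup_gen (@strand_gen k i)) v) =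
    pres_class _ v.
  have phi1 : phi 1 = 1 by apply: (mulgI (phi 1)); rewrite -phiM !mulg1.
  rewrite pres_class_eval; elim: v => [|[j e] v IH]; first by rewrite !word_eval_nil.
  rewrite !word_eval_cons phiM IH; congr (_ * _); case: e => /=; first exact: phi_gen.
  transitivity (phi (subgroup_gen (@strand_gen k i) j))^-1; last by rewrite phi_gen.
  by apply/esym/mulg1_eq; rewrite -phiM mulgV.
have [v gE] := strand_val_word g; have [v' hE] := strand_val_word h.
rewrite gE hE; apply: (word_eval_pres (rels := fun _ _ => False)) => //.
by apply/pres_classP; rewrite -!phi_word -gE -hE.
Qed.

End StrandGroups.

(** * The combing theorem *)

Section DescendingIndices.

Variable n : nat.

(** The order in which the factors of a combed braid are multiplied, cut off at
    [m] for inductions on the number of strands. *)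
Definition desc m : seq 'I_n := [seq i : 'I_n <- rev (enum 'I_n) | (i < m)%N].

Lemma desc_val m : (m <= n)%N -> map val (desc m) = rev (iota 0 m).
Proof.
move=> mn.
have -> : map val (desc m) = [seq a <- rev (map val (enum 'I_n)) | (a < m)%N].
  by rewrite -map_rev filter_map.
rewrite val_enum_ord filter_rev; congr rev.
rewrite -{1}(subnKC mn) iotaD filter_cat add0n.
have /all_filterP -> : all (fun a => a < m)%N (iota 0 m).
  by apply/allP => a; rewrite mem_iota.
rewrite -[RHS]cats0; congr cat; apply/eqP; rewrite -[_ == _]negbK -has_filter.
by apply/hasPn => a; rewrite mem_iota -leqNgt => /andP[].
Qed.

Lemma descS (i : 'I_n) : desc i.+1 = i :: desc i.
Proof.
apply: (inj_map val_inj); rewrite /= !desc_val //; last exact: ltnW.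
by rewrite -addn1 iotaD rev_cat.
Qed.

Lemma desc0 : desc 0 = [::].
Proof. by rewrite /desc; elim: (rev _). Qed.

Lemma desc_full : desc n = rev (enum 'I_n).
Proof. by apply/all_filterP/allP => i _ /=. Qed.

Lemma mem_desc m i : (i \in desc m) = (i < m)%N.
Proof. by rewrite mem_filter mem_rev mem_enum andbT. Qed.

Lemma desc_uniq m : uniq (desc m).
Proof. by rewrite filter_uniq // rev_uniq enum_uniq. Qed.

Lemma desc_ind (P : nat -> Prop) : P 0%N ->
  (forall i : 'I_n, P i -> P i.+1) -> forall m, (m <= n)%N -> P m.
Proof.
move=> P0 PS; elim=> // m IH mn.
by apply: (PS (Ordinal mn)); apply/IH/ltnW.
Qed.

End DescendingIndices.

Section Combing.

Local Open Scope group_scope.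

Variable k : nat.
Local Notation s := (@nat_sigma k).

Definition comb_below (p : strand_prod k) m : pure_braid k :=
  \prod_(i <- desc k.-1 m) gen_subgroup_val (p i).

Lemma comb_evalE p : comb_eval p = comb_below p k.-1.
Proof. by rewrite /comb_below desc_full. Qed.

Lemma comb_belowS p (i : 'I_k.-1) :
  comb_below p i.+1 = gen_subgroup_val (p i) * comb_below p i.
Proof. by rewrite /comb_below descS big_cons. Qed.

Lemma link_word d j : exists2 w, letters_below (j + d).+1 w &
  link s d j = word_eval s w.
Proof.
elim: d j => [|d IH] j.
  exists [:: (j, true); (j, true)]; first by rewrite /letters_below /= addn0 ltnSn.
  by rewrite !word_eval_cons word_eval_nil mulg1.
have [w wj wE] := IH j.+1.
exists ((j, false) :: rcons w (j, true)).
  rewrite /letters_below /= all_rcons addnS -addSn.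
  by move: wj; rewrite /letters_below => -> /=; rewrite andbT; lia.
by rewrite word_eval_cons word_eval_rcons /= -wE.
Qed.

Lemma strand_word (i : 'I_k.-1) (g : strand_group i) :
  exists2 w, letters_below i.+1 w & strand_val g = word_eval s w.
Proof.
move: (strand_val g) (strand_val_generated g) => {g}.
apply: generated_ind => [|_ _ [u ui ->] [w wi ->]|_ [w wi ->]|j].
- by exists [::]; rewrite ?word_eval_nil.
- exists (u ++ w); last by rewrite word_eval_cat.
  by rewrite /letters_below all_cat; apply/andP.
- exists (word_inv w); last by rewrite word_eval_inv.
  by rewrite /letters_below /word_inv all_rev all_map.
have [w wi wE] := link_word (i - j) j; exists w => //.
by rewrite subnKC -1?ltnS // in wi.
Qed.

Lemma comb_below_word p m : (m <= k.-1)%N ->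
  exists2 w, letters_below m w & pure_val (comb_below p m) = word_eval s w.
Proof.
move: m; apply: desc_ind => [|i [w wi wE]].
  by exists [::]; rewrite // /comb_below desc0 big_nil word_eval_nil.
have [u ui uE] := strand_word (p i).
exists (u ++ w); last by rewrite word_eval_cat -uE -wE comb_belowS.
rewrite /letters_below all_cat; apply/andP; split=> //.
exact: letters_below_leq wi.
Qed.

Lemma comb_below_inj p q m : (m <= k.-1)%N -> comb_below p m = comb_below q m ->
  forall i : 'I_k.-1, (i < m)%N -> p i = q i.
Proof.
move: m; apply: desc_ind => // i IH; rewrite !comb_belowS => E.
have pqi : p i = q i.
  have [u ui uE] := comb_below_word p (ltnW (ltn_ord i)).
  have [w wi wE] := comb_below_word q (ltnW (ltn_ord i)).
  apply: (strand_unique ui wi); rewrite -uE -wE.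
  by have /= := congr1 (fun b : pure_braid k => pure_val b) E.
move=> j; rewrite ltnS leq_eqVlt => /predU1P[/val_inj -> //|].
by apply: IH; move: E; rewrite pqi => /mulgI.
Qed.

Lemma cascade_perm d j (t : 'I_k) : t = (j + d)%N :> nat ->
  braid_perm (cascade s d j) t = j :> nat.
Proof.
elim: d t => [|d IH] t td; first by rewrite braid_perm1 perm1 td addn0.
rewrite braid_permM permM IH //; have := ltn_ord t => tk.
rewrite nat_sigma_permE /swapn; last by lia.
by rewrite td addnS eqxx (_ : (_.+1 == _) = false) //; lia.
Qed.

Lemma word_perm_above i w (t : 'I_k) : letters_below i w -> (i < t)%N ->
  braid_perm (word_eval s w) t = t.
Proof.
move=> wi it; apply: val_inj; rewrite /= word_permE; last first.
  by apply: letters_below_leq wi; have := ltn_ord t; lia.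
elim: w wi => //= -[a e] w IH /andP[/= ai /IH].
by rewrite /swapn !gtn_eqF //; lia.
Qed.

(** The permutation of a pure braid forces its cascade to be trivial, which
    splits off the factor of the last strand. *)
Lemma comb_below_exists m w (b : pure_braid k) : (m <= k.-1)%N ->
  letters_below m w -> pure_val b = word_eval s w ->
  exists p, comb_below p m = b.
Proof.
move=> mk; move: m mk w b; apply: desc_ind => [w b|i IH w b wi bE].
  case: w => // _ bE; exists 1; apply: val_inj.
  by rewrite /comb_below desc0 big_nil /= bE word_eval_nil.
have [_ /generated_strand_val[g <-] [u ui [d di wE]]] :=
  cascade_decomposition (nat_sigma_relations k) (ltn_ord i) wi.
have ik : (i.+1 < k)%N by have := ltn_ord i; lia.
have d0 : d = 0%N.
  have /eqP gP : braid_perm (strand_val g) == 1 by exact: (valP (gen_subgroup_val g)).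
  have /eqP bP : braid_perm b == 1 by exact: (valP b).
  have := congr1 (fun q : 'S_k => nat_of_ord (q (Ordinal ik))) bP.
  rewrite bE wE !braid_permM gP mul1g permM perm1.
  rewrite (word_perm_above (i := i) ui) //.
  by rewrite cascade_perm /= ?subnK //; lia.
rewrite d0 mulg1 in wE.
have [p' p'E] := IH u ((gen_subgroup_val g)^-1 * b) ui
  (canLR (mulKg _) (etrans bE wE)).
exists (fun j => dfwith p' g j); rewrite comb_belowS dfwith_in.
have -> : comb_below (fun j => dfwith p' g j) i = comb_below p' i.
  rewrite /comb_below; apply: eq_big_seq => j; rewrite mem_desc => ji.
  by rewrite dfwith_out // -val_eqE /= gtn_eqF.
by rewrite p'E mulVKg.
Qed.

Lemma comb_eval_inj : injective (@comb_eval k).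
Proof.
move=> p q; rewrite !comb_evalE => /comb_below_inj E.
by apply: functional_extensionality_dep => i; apply: E.
Qed.

Lemma combK : cancel (@comb k) (@comb_eval k).
Proof.
move=> b; have [w wk bE] := braid_word b.
have [p pE] := comb_below_exists (leqnn _) wk bE.
by rewrite /comb; case: xgetP => [q _ //|/(_ p)]; rewrite /= comb_evalE.
Qed.

Lemma comb_evalK : cancel (@comb_eval k) (@comb k).
Proof. by move=> p; apply: comb_eval_inj; rewrite combK. Qed.

End Combing.

(** * Finite type invariants and augmentation powers *)

Section PureBraidGeneration.

Local Open Scope group_scope.

Variable k : nat.

Lemma pure_braid_ind (P : pure_braid k -> Prop) :
  P 1 -> (forall b c, P b -> P c -> P (b * c)) -> (forall b, P b -> P b^-1) ->
  (forall i j, P (@strand_gen k i j)) -> forall b, P b.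
Proof.
move=> P1 PM PV Pgen b; rewrite -[b]combK /comb_eval.
elim/big_ind: _ => // i _; case: (comb b i) => g /= gP.
by move: g gP; apply: generated_ind => // j; apply: Pgen.
Qed.

End PureBraidGeneration.

Section FiniteType.

Variables (R : comPzRingType) (k : nat).
Local Notation P := (pure_braid k).
Local Notation RP := (group_ring R P).
Implicit Types (w : singular_braid k) (a : RP).

Lemma resolve_cat u w : resolve R (u ++ w) = resolve R u * resolve R w.
Proof. exact: big_cat. Qed.

Lemma resolve_cons l w : resolve R (l :: w) = resolve R [:: l] * resolve R w.
Proof. by rewrite -cat1s resolve_cat. Qed.

Lemma double_points_cat u w :
  double_points (u ++ w) = (double_points u + double_points w)%N.
Proof. exact: count_cat. Qed.

Definition plain (u : seq ('I_k.-1 * bool)) : singular_braid k :=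
  [seq (l.1, if l.2 then Positive else Negative) | l <- u].

Lemma resolve_plain u : resolve R (plain u) = gr_of R (word_eval (@sigma k) u).
Proof.
elim: u => [|[i e] u IH]; first by rewrite /resolve big_nil word_eval_nil.
rewrite word_eval_cons gr_ofM -IH [plain _]/= resolve_cons /resolve big_seq1.
by case: e.
Qed.

Definition singular_perm w : 'S_k := (\prod_(l <- w) sigma_perm l.1)%g.

Lemma singular_perm_cat u w :
  singular_perm (u ++ w) = (singular_perm u * singular_perm w)%g.
Proof. exact: big_cat. Qed.

Lemma singular_perm_plain u :
  singular_perm (plain u) = braid_perm (word_eval (@sigma k) u).
Proof.
rewrite -pres_class_eval braid_perm_class /singular_perm /word_perm.
by rewrite big_map.
Qed.

Definition singular_element n a := exists w,
  [/\ singular_perm w = 1%g, (n <= double_points w)%N &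
      gr_map (@pure_val k) a = resolve R w].

Lemma pure_valM : {morph @pure_val k : b c / (b * c)%g}.
Proof. by []. Qed.

Lemma braid_sigma_word (b : braid k) : exists u, b = word_eval (@sigma k) u.
Proof. by exists (repr b); rewrite -pres_class_eval pres_reprK. Qed.

Lemma singular_elementM n a (b : P) :
  singular_element n a -> singular_element n (a * gr_of R b).
Proof.
move=> [w [w1 nw aw]]; have [u bu] := braid_sigma_word (pure_val b).
exists (w ++ plain u); rewrite singular_perm_cat w1 singular_perm_plain -bu.
split; first by rewrite mul1g; apply/eqP/(valP b).
  by rewrite double_points_cat; apply: leq_trans nw (leq_addr _ _).
by rewrite (gr_mapM pure_valM) aw gr_map_of resolve_cat resolve_plain bu.
Qed.

(** The generators are conjugates of full twists, and a full twist minus the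
    trivial braid is a double point followed by a crossing. *)
Lemma singular_elementM_gen n a i j :
  singular_element n a -> singular_element n.+1 (a * (gr_of R (@strand_gen k i j) - 1)).
Proof.
move=> [w [w1 nw aw]].
pose c := (\prod_(a <- rev (enum 'I_k.-1) | (j <= a < i)%N) sigma a)%g.
have [u cu] := braid_sigma_word c.
pose tail := (i, Positive) :: plain u.
exists (w ++ plain (word_inv u) ++ (i, Double) :: tail); split.
- have := @strand_braid_pure k i j; rewrite unfold_in => /eqP <-.
  rewrite singular_perm_cat w1 mul1g singular_perm_cat singular_perm_plain.
  rewrite word_eval_inv -cu /strand_braid -/c !braid_permM.
  rewrite /singular_perm !big_cons -/(singular_perm _) singular_perm_plain -cu.
  by rewrite !braid_perm_sigma !mulgA.
- rewrite !double_points_cat.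
  rewrite (_ : double_points ((i, Double) :: tail) = (double_points tail).+1) //.
  lia.
rewrite (gr_mapM pure_valM) aw !resolve_cat; congr (_ * _).
rewrite resolve_plain word_eval_inv -cu.
rewrite (resolve_cons (i, Double)) (resolve_cons (i, Positive)) resolve_plain -cu.
rewrite /resolve !big_seq1 /= linearB /= gr_map_of (gr_map1 _ pure_valM) /=.
rewrite mulrBl mulrBr -!gr_ofM mulKg mulVg gr_of1 /strand_braid -/c.
by rewrite -[(_ ^+ 2)%g]/(sigma i * sigma i)%g !mulgA.
Qed.

Lemma singular_element_aug n a (b : P) : singular_element n a ->
  lspan (singular_element n.+1) (a * (gr_of R b - 1)).
Proof.
move: b a; apply: pure_braid_ind => [|b c IHb IHc|b IHb|i j] a aS.
- by rewrite gr_of1 subrr mulr0; constructor.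
- have -> : a * (gr_of R (b * c)%g - 1) =
    a * gr_of R b * (gr_of R c - 1) + a * (gr_of R b - 1).
    by rewrite gr_ofM mulrBr mulr1 -!mulrA !mulrBr !mulr1 addrA subrK.
  by apply: lspanD; [apply/IHc/singular_elementM | apply: IHb].
- have -> : a * (gr_of R b^-1%g - 1) = 0 - a * gr_of R b^-1%g * (gr_of R b - 1).
    by rewrite !mulrBr !mulr1 -mulrA -gr_ofM mulVg gr_of1 mulr1 sub0r opprB.
  by apply: lspanB; [constructor | apply/IHb/singular_elementM].
exact/lspan_in/singular_elementM_gen.
Qed.

Lemma aug_pow_singular n a : a \in @aug_pow R P n -> lspan (singular_element n) a.
Proof.
elim: n a => [|n IH] a.
  move=> _; rewrite (gr_decomp a); apply: lspan_sum => b _; apply/lspanZ/lspan_in.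
  rewrite -[gr_of R b]mul1r; apply: singular_elementM.
  by exists [::]; rewrite /singular_perm /resolve !big_nil (gr_map1 _ pure_valM).
move=> /aug_powS_span; apply: lspan_least => _ [x [y [/IH xS /aug_ker_span yS ->]]].
apply: (lspan_image (V := RP) (W := RP) (f := fun x => x * y) _ _ xS) => [t u v|z zS].
  by rewrite mulrDl gr_scalerAl.
apply: (lspan_image (V := RP) (W := RP) (f := fun y => z * y) _ _ yS)
  => [t u v|_ [b ->]].
  by rewrite mulrDr gr_scalerAr.
exact: singular_element_aug.
Qed.

Lemma of_type_aug_pow n (v : P -> R) a : of_type n v ->
  a \in @aug_pow R P n.+1 -> lin_ext (v : P -> R^o) a = 0.
Proof.
move=> vn /aug_pow_singular; elim=> [|c x y [w [w1 nw xw]] _ IH].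
  by rewrite linear0.
by rewrite linearP /= IH (vn w x w1 nw xw) scaler0 addr0.
Qed.

End FiniteType.

(** * The Magnus expansion of a free group *)

Section SeriesFacts.

Variables (R : comPzRingType) (I : choiceType).
Local Notation S := (nc_series R I).
Implicit Types (f g h : S) (w : seq I).

Lemma nc_mulE f g w : (f * g) w =
  \sum_(i < (size w).+1) (f (take i w) : R) * g (drop i w).
Proof. by []. Qed.

Lemma nc_mul_nil f g : (f * g) [::] = (f [::] : R) * g [::].
Proof. by rewrite nc_mulE big_ord_recl big_ord0 addr0. Qed.

Lemma nc_scalerAl (c : R) f g : c *: (f * g) = (c *: f) * g.
Proof.
apply/funext => w; rewrite -[LHS]/(c * (f * g) w) !nc_mulE mulr_sumr.
by apply: eq_bigr => i _; rewrite mulrA.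
Qed.

Lemma nc_scalerAr (c : R) f g : c *: (f * g) = f * (c *: g).
Proof.
apply/funext => w; rewrite -[LHS]/(c * (f * g) w) !nc_mulE mulr_sumr.
by apply: eq_bigr => i _; rewrite mulrCA.
Qed.

Lemma nc_var_mul j f a w :
  (nc_var R j * f) (a :: w) = if a == j then f w else 0.
Proof.
rewrite nc_mulE !big_ord_recl /= !take0 !drop0 big1 => [|i _].
  rewrite /nc_var /= mul0r add0r addr0 eqseq_cons eqxx andbT.
  by case: eqP; rewrite ?mul1r ?mul0r.
case: w i => [[]//|b w i]; rewrite /= {1}/nc_var.
by rewrite !eqseq_cons andbF mul0r.
Qed.

Lemma nc_var_mul_nil j f : (nc_var R j * f) [::] = 0.
Proof. by rewrite nc_mul_nil mul0r. Qed.

(** The alternating geometric series. *)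
Definition nc_var_inv (j : I) : S :=
  fun w => if all (pred1 j) w then (-1) ^+ size w else 0.

Lemma nc_var_mulV j : (1 + nc_var R j) * nc_var_inv j = 1.
Proof.
apply/funext => w; rewrite mulrDl mul1r.
rewrite -[LHS]/(nc_var_inv j w + (nc_var R j * nc_var_inv j) w).
rewrite -[RHS]/((w == [::])%:R).
case: w => [|a w]; first by rewrite nc_var_mul_nil addr0.
rewrite nc_var_mul /nc_var_inv /=; case: (a == j); last by rewrite addr0.
by case: (all _ w); rewrite ?addr0 //= exprS mulN1r addNr.
Qed.

(** Left cancellation, which makes a right inverse of [1 + X_j] two-sided. *)
Lemma nc_var_mulI j f : (1 + nc_var R j) * f = 0 -> f = 0.
Proof.
rewrite mulrDl mul1r => E; apply/funext; elim=> [|a w IH].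
  have : (f + nc_var R j * f) [::] = 0 by rewrite E.
  by rewrite -[LHS]/(f [::] + (nc_var R j * f) [::]) nc_var_mul_nil addr0.
have : (f + nc_var R j * f) (a :: w) = 0 by rewrite E.
rewrite -[LHS]/(f (a :: w) + (nc_var R j * f) (a :: w)) nc_var_mul IH.
by rewrite if_same addr0.
Qed.

Lemma nc_var_mulVl j : nc_var_inv j * (1 + nc_var R j) = 1.
Proof.
apply/subr0_eq/(nc_var_mulI (j := j)).
by rewrite mulrBr mulrA nc_var_mulV mul1r mulr1 subrr.
Qed.

Definition nc_word (u : seq (I * bool)) : S :=
  \prod_(l <- u) (if l.2 then 1 + nc_var R l.1 else nc_var_inv l.1).

Lemma nc_word_cat (u w : seq (I * bool)) : nc_word (u ++ w) = nc_word u * nc_word w.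
Proof. exact: big_cat. Qed.

Lemma nc_word_pres (u w : seq (I * bool)) :
  pres_eq (fun _ _ => False) u w -> nc_word u = nc_word w.
Proof.
elim=> {u w} //.
- move=> j b; rewrite /nc_word !big_cons big_nil mulr1 /=.
  by case: b; rewrite /= ?nc_var_mulV ?nc_var_mulVl.
- by move=> u v w _ -> _ ->.
- by move=> u u' v v' _ uu' _ vv'; rewrite !nc_word_cat uu' vv'.
Qed.

Definition free_group_magnus (c : free_group I) : S := nc_word (repr c).

Lemma free_group_magnusM c d :
  free_group_magnus (c * d)%g = free_group_magnus c * free_group_magnus d.
Proof.
rewrite /free_group_magnus -nc_word_cat; apply: nc_word_pres.
exact: pres_eq_repr.
Qed.

Lemma free_group_magnus1 : free_group_magnus 1%g = 1.
Proof.
transitivity (nc_word [::]); last exact: big_nil.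
exact/nc_word_pres/pres_eq_repr.
Qed.

Lemma free_group_magnus_gen j :
  free_group_magnus (free_gen j) = 1 + nc_var R j.
Proof.
transitivity (nc_word [:: (j, true)]); last by rewrite /nc_word big_seq1.
exact/nc_word_pres/pres_eq_repr.
Qed.

End SeriesFacts.

Section FreeMagnus.

Variables (R : comPzRingType) (G : groupType) (m : nat) (x : 'I_m -> G).
Local Notation RG := (group_ring R G).
Local Notation J n := (@aug_pow R G n).

Definition magnus_spec (F : RG -> nc_series R 'I_m) :=
  [/\ linear F, GRing.monoid_morphism F &
      forall j, F (gr_of R (x j)) = 1 + nc_var R j].

Lemma magnus_spec_exists (phi : G -> free_group 'I_m) :
  {morph phi : g h / (g * h)%g} -> (forall j, phi (x j) = free_gen j) ->
  exists F, magnus_spec F.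
Proof.
move=> phiM phix; pose F : RG -> nc_series R 'I_m :=
  lin_ext (fun g => free_group_magnus R (phi g)).
have Flin : linear F by apply: lin_ext_linear.
have Fof g : F (gr_of R g) = free_group_magnus R (phi g) by apply: lin_ext_of.
exists F; split=> // [|j]; last by rewrite Fof phix free_group_magnus_gen.
split.
  rewrite -gr_of1 Fof (_ : phi 1%g = 1%g) ?free_group_magnus1 //.
  by apply: (mulgI (phi 1%g)); rewrite -phiM !mulg1.
move=> a b.
apply: (gr_linear_eq (f := fun a => F (a * b))
  (h := fun a => F a * F b)) => [t u v|t u v|g].
- by rewrite mulrDl -gr_scalerAl Flin.
- by rewrite Flin mulrDl nc_scalerAl.
apply: (gr_linear_eq (f := fun b => F (gr_of R g * b))
  (h := fun b => F (gr_of R g) * F b)) => [t u v|t u v|h].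
- by rewrite mulrDr -gr_scalerAr Flin.
- by rewrite Flin mulrDr nc_scalerAr.
by rewrite -gr_ofM !Fof phiM free_group_magnusM.
Qed.

Variable F : RG -> nc_series R 'I_m.
Hypothesis F_spec : magnus_spec F.
Hypothesis gen : forall g, exists w, g = word_eval x w.

Let F_linear : linear F. Proof. by case: F_spec. Qed.
Let FM a b : F (a * b) = F a * F b.
Proof. by case: F_spec => _ [_ fM] _; apply: fM. Qed.
Let F1 : F 1 = 1. Proof. by case: F_spec => _ [f1 _] _; apply: f1. Qed.
Let F_gen j : F (gr_of R (x j)) = 1 + nc_var R j. Proof. by case: F_spec. Qed.
Let FB a b : F (a - b) = F a - F b.
Proof. by rewrite addrC -scaleN1r F_linear scaleN1r addrC. Qed.

Lemma gen_ind (P : G -> Prop) :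
  P 1%g -> (forall g h, P g -> P h -> P (g * h)%g) -> (forall g, P g -> P g^-1%g) ->
  (forall j, P (x j)) -> forall g, P g.
Proof.
move=> P1 PM PV Px g; have gG : g \in generated x by apply/asboolP/gen.
exact: generated_ind gG.
Qed.

Lemma magnus_nil (a : RG) : F a [::] = gr_aug a.
Proof.
apply: (gr_linear_eq (V := R^o) (f := fun a => F a [::])
  (h := fun a => gr_aug a)) => [t u v|t u v|].
- by rewrite F_linear.
- by rewrite gr_aug_linear.
move=> g; rewrite gr_aug_of; move: g; apply: gen_ind => [|g h gE hE|g gE|j].
- by rewrite gr_of1 F1.
- by rewrite gr_ofM FM nc_mul_nil gE hE mulr1.
- have : F (gr_of R (g * g^-1)%g) [::] = 1 by rewrite mulgV gr_of1 F1.
  by rewrite gr_ofM FM nc_mul_nil gE mul1r.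
by rewrite F_gen; apply: addr0.
Qed.

(** The constant term is the augmentation, hence each factor in the augmentation
    ideal raises the order of the series. *)
Lemma magnus_order n (a : RG) w : a \in J n -> (size w < n)%N -> F a w = 0.
Proof.
elim: n a w => // n IH a w /aug_powS_span; elim=> [|t _ y [u [v [uJ v0 ->]]] _ IHy] wn.
  by rewrite -(subrr (0 : RG)) FB subrr.
rewrite F_linear -[LHS]/(t * F (u * v) w + F y w) IHy // addr0 FM nc_mulE.
rewrite big1 ?mulr0 // => i _; have [iw|wi] := ltnP i (size w).
  rewrite IH ?mul0r // size_take iw.
  by rewrite ltnS in wn; apply: leq_trans wn.
by rewrite drop_oversize // magnus_nil v0 mulr0.
Qed.

(** The part of degree [n] of the expansion, with the monomials [X_w] replaced
    by the elements of [J^n] whose classes they stand for. *)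
Definition magnus_part n (a : RG) : RG :=
  \sum_(w : n.-tuple 'I_m) (F a w : R) *: \prod_(j <- w) (gr_of R (x j) - 1).

Lemma magnus_part_linear n : linear (magnus_part n).
Proof.
move=> t a b; rewrite /magnus_part scaler_sumr -big_split.
apply: eq_bigr => w _; rewrite F_linear scalerA.
exact: (scalerDl _ (t * F a w : R)).
Qed.

Lemma magnus_part_pow n a : magnus_part n a \in J n.
Proof.
apply: rpred_sum => w _; apply: rpredZ; rewrite -{2}(size_tuple w).
elim: (w : seq _) => {w} [|j w IH]; first by rewrite big_nil.
rewrite big_cons; apply: (@aug_powM _ _ 1 (size w)) => //.
exact/aug_pow1/gr_aug_ofB1.
Qed.

Lemma magnus_part_order e n a : a \in J e -> (n < e)%N -> magnus_part n a = 0.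
Proof.
move=> aJ ne; apply: big1 => w _; rewrite (magnus_order aJ) ?scale0r //.
by rewrite size_tuple.
Qed.

Lemma magnus_part0 a : magnus_part 0 a = (gr_aug a : R) *: (1 : RG).
Proof.
rewrite /magnus_part (big_pred1 [tuple]) => [|w]; last first.
  by rewrite (tuple0 w); apply/esym/eqP.
by rewrite big_nil magnus_nil.
Qed.

Lemma magnus_partS n a : magnus_part n.+1 a =
  \sum_j \sum_(w : n.-tuple 'I_m) (F a (j :: w) : R) *:
    ((gr_of R (x j) - 1) * \prod_(i <- w) (gr_of R (x i) - 1)).
Proof.
rewrite pair_big /= /magnus_part.
rewrite (reindex (fun p : 'I_m * n.-tuple 'I_m => [tuple of p.1 :: p.2])) /=.
  by apply: eq_bigr => -[j w] _; rewrite big_cons.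
exists (fun w => (thead w, [tuple of behead w])) => [[j w]|w] _ /=.
  by congr pair; apply: val_inj.
by rewrite -tuple_eta.
Qed.

Lemma magnus_part1 a :
  magnus_part 1 a = \sum_j (F a [:: j] : R) *: (gr_of R (x j) - 1).
Proof.
rewrite magnus_partS; apply: eq_bigr => j _.
rewrite (big_pred1 [tuple]) => [|w]; last first.
  by rewrite (tuple0 w); apply/esym/eqP.
by rewrite big_nil mulr1.
Qed.

(** Modulo the square of the augmentation ideal, [g - 1] is additive in [g], and
    so is the linear part of its expansion; it suffices to compare them on the
    generators. *)
Lemma magnus_part1_id a : gr_aug a = 0 -> a - magnus_part 1 a \in J 2.
Proof.
pose D b := b - magnus_part 1 b; rewrite -/(D a).
have D_linear : linear D.
  by move=> t u v; rewrite /D magnus_part_linear opprD addrACA -scalerBr.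
have DD u v : D (u + v) = D u + D v by rewrite -[u]scale1r D_linear !scale1r.
have D0 : D 0 = 0 by apply: (addrI (D 0)); rewrite -DD !addr0.
have DN u : D (- u) = - D u by apply: (addrI (D u)); rewrite -DD !subrr.
have D2 u : u \in J 2 -> D u \in J 2.
  by move=> uJ; rewrite /D (magnus_part_order uJ) // subr0.
have JM g h : (gr_of R (g : G) - 1) * (gr_of R (h : G) - 1) \in J 2.
  by apply: (@aug_powM _ _ 1 1); apply/aug_pow1/gr_aug_ofB1.
suff Dg g : D (gr_of R g - 1) \in J 2.
  move=> /aug_ker_span; elim=> [|t _ y [g ->] _ IH].
    by rewrite D0 rpred0.
  by rewrite D_linear rpredD ?rpredZ.
move: g; apply: gen_ind => [|g h gE hE|g gE|j].
- by rewrite gr_of1 subrr D0 rpred0.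
- have -> : gr_of R (g * h)%g - 1 =
    (gr_of R g - 1) * (gr_of R h - 1) + ((gr_of R g - 1) + (gr_of R h - 1)).
    rewrite mulrBl mul1r mulrBr mulr1 -gr_ofM.
    by rewrite [gr_of R g - 1 + _]addrC addrA subrK addrA subrK.
  rewrite DD [D (_ - 1 + _)]DD; apply: rpredD; first exact/D2/JM.
  exact: rpredD.
- have -> : gr_of R g^-1%g - 1 =
    - ((gr_of R g - 1) + (gr_of R g - 1) * (gr_of R g^-1%g - 1)).
    rewrite mulrBr mulr1 [in RHS]addrC subrK mulrBl mul1r -gr_ofM mulgV gr_of1.
    by rewrite opprB.
  rewrite DN rpredN DD; apply: rpredD => //; exact/D2/JM.
have FX : F (gr_of R (x j) - 1) = nc_var R j by rewrite FB F_gen F1 addrC addKr.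
rewrite /D magnus_part1 FX (bigD1 j) // big1 => [|i /= ij].
  by rewrite [X in _ - X]/= addr0 /nc_var eqxx scale1r subrr rpred0.
by rewrite /nc_var eqseq_cons andbT (negPf ij) scale0r.
Qed.

Lemma magnus_partSM n a b : gr_aug a = 0 -> b \in J n ->
  magnus_part n.+1 (a * b) = magnus_part 1 a * magnus_part n b.
Proof.
move=> a0 bJ; rewrite magnus_partS magnus_part1 mulr_suml.
apply: eq_bigr => j _; rewrite /magnus_part mulr_sumr.
apply: eq_bigr => w _; rewrite -gr_scalerAl -gr_scalerAr scalerA; congr (_ *: _).
rewrite FM nc_mulE big_ord_recl /= magnus_nil a0 mul0r add0r.
rewrite big_ord_recl /= take0 drop0 big1 ?addr0 // => i _.
rewrite (magnus_order bJ) ?mulr0 // size_drop /bump /=.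
have iw := ltn_ord i; rewrite -[n in (_ < n)%N](size_tuple w) ltn_subrL /=.
exact: leq_ltn_trans iw.
Qed.

(** The leading terms of a product multiply, so that the essential case is that of
    degree 1. *)
Lemma magnus_part_id n a : a \in J n -> a - magnus_part n a \in J n.+1.
Proof.
elim: n a => [|n IH] a.
  move=> _; apply/aug_pow1; rewrite magnus_part0 addrC -scaleNr gr_aug_linear.
  by rewrite -gr_of1 gr_aug_of -[X in X + _]/(- (gr_aug a : R) * 1) mulr1 addNr.
move=> /aug_powS_spanl; elim=> [|t _ y [u [v [u0 vJ ->]]] _ IHy].
  by rewrite (magnus_part_order (e := n.+2)) ?subr0 ?rpred0.
rewrite magnus_part_linear opprD addrACA -scalerBr rpredD // rpredZ //.
rewrite magnus_partSM //.
have -> : u * v - magnus_part 1 u * magnus_part n v =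
    (u - magnus_part 1 u) * v + magnus_part 1 u * (v - magnus_part n v).
  by rewrite mulrBl mulrBr addrA subrK.
apply: rpredD.
  by apply: (@aug_powM _ _ 2 n) => //; apply: magnus_part1_id.
by apply: (@aug_powM _ _ 1 n.+1); [apply: magnus_part_pow | apply: IH].
Qed.

End FreeMagnus.

(** * Multilinear maps on group rings *)

Section Multilinear.

Variables (R : comPzRingType) (I : finType) (H : I -> groupType).
Local Notation tensors := (forall i, group_ring R (H i)).

Definition multilinear (V : lmodType R) (Phi : tensors -> V) :=
  forall (a : tensors) i, linear (fun x : group_ring R (H i) => Phi (dfwith a x)).

(** A tensor product of group rings is the group ring of the product, hence
    multilinear maps are determined by their values on group elements. *)
Lemma multilinear_eq (V : lmodType R) (Phi Psi : tensors -> V) :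
  multilinear Phi -> multilinear Psi ->
  (forall g : (forall i, H i),
    Phi (fun i => gr_of R (g i)) = Psi (fun i => gr_of R (g i))) ->
  Phi =1 Psi.
Proof.
move=> PhiL PsiL E a.
suff gen (s : seq I) : (forall i, i \notin s -> exists g, a i = gr_of R g) ->
    Phi a = Psi a.
  by apply: (gen (enum I)) => i; rewrite mem_enum.
elim: s a => [|j s IH] a aP.
  pose g i := projT1 (cid (aP i isT)).
  have -> : a = fun i => gr_of R (g i).
    by apply: functional_extensionality_dep => i; rewrite /g; case: cid.
  exact: E.
have -> : a = dfwith a (a j).
  by apply: functional_extensionality_dep => i; case: dfwithP.
move: (a j) => x; apply: (gr_linear_eq (f := fun x => Phi (dfwith a x))
  (h := fun x => Psi (dfwith a x))) => // g.
apply: IH => i; case: dfwithP => [_|i' ji' i's]; first by exists g.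
by apply: aP; rewrite inE negb_or eq_sym ji'.
Qed.

Lemma multilinear_linear (V W : lmodType R) (Phi : tensors -> V) (L : V -> W) :
  linear L -> multilinear Phi -> multilinear (L \o Phi).
Proof. by move=> LL PhiL a i t x y /=; rewrite PhiL LL. Qed.

Lemma multilinear_sum (V : lmodType R) J (r : seq J) (Q : pred J)
    (Phi : J -> tensors -> V) :
  (forall j, multilinear (Phi j)) -> multilinear (fun a => \sum_(j <- r | Q j) Phi j a).
Proof.
move=> PhiL a i t x y; rewrite scaler_sumr -big_split.
by apply: eq_bigr => j _; apply: PhiL.
Qed.

Lemma multilinear_prod (G : groupType)
    (F : forall i, group_ring R (H i) -> group_ring R G) (s : seq I) :
  (forall i, linear (F i)) -> uniq s -> (forall i, i \in s) ->
  multilinear (fun a => \prod_(i <- s) F i (a i)).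
Proof.
move=> Flin s_uniq s_full a i.
suff [A [B E]] : exists A B, forall x : group_ring R (H i),
    \prod_(j <- s) F j (dfwith a x j) = A * F i x * B.
  move=> t x y; rewrite !E Flin mulrDr mulrDl; congr (_ + _).
  by rewrite -gr_scalerAr -gr_scalerAl.
elim: s {s_full} (s_full i) s_uniq => // j s IH.
rewrite inE /= => /predU1P[->|is_] /andP[js s_uniq].
  exists 1, (\prod_(l <- s) F l (a l)) => x; rewrite big_cons dfwith_in mul1r.
  congr (_ * _); apply: eq_big_seq => l ls; rewrite dfwith_out //.
  by apply: contraNneq js => ->.
have [A [B E]] := IH is_ s_uniq; exists (F j (a j) * A), B => x.
rewrite big_cons E dfwith_out ?mulrA //.
by apply: contraNneq js => <-.
Qed.

End Multilinear.

(** * Augmentation powers of almost direct products *)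

Section TrivialOnFirstPiece.

Variables (R : comPzRingType) (H : groupType) (al : H -> H).
Local Notation J n := (@aug_pow R H n).

Hypothesis alM : {morph al : x y / (x * y)%g}.
Hypothesis al2 : forall x, gr_of R (al x) - gr_of R x \in J 2.

(** For a product of elements of [J], the difference is a sum of products in
    which one of the factors is replaced by a difference, which is in [J^2]. *)
Lemma gr_map_trivial p a : a \in J p -> gr_map al a - a \in J p.+1.
Proof.
have E b : gr_map al b - b \in J 2.
  have mapZ t (c : group_ring R H) : gr_map al (t *: c) = t *: gr_map al c.
    by rewrite linearZ.
  rewrite (gr_decomp b) linear_sum -sumrB rpred_sum // => g _.
  suff: gr_map al ((b g : R) *: gr_of R g) - (b g : R) *: gr_of R g \in J 2 by [].
  by rewrite mapZ gr_map_of -scalerBr rpredZ.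
elim: p a => [|p IH] a; first by move=> _; apply: aug_pow_anti (E a).
move=> /aug_powS_span; elim=> [|t _ y [u [v [uJ v0 ->]]] _ IHy].
  by rewrite linear0 subr0 rpred0.
rewrite gr_map_linear opprD addrACA -scalerBr rpredD // rpredZ // (gr_mapM alM).
have -> : gr_map al u * gr_map al v - u * v =
    (gr_map al u - u) * gr_map al v + u * (gr_map al v - v).
  by rewrite mulrBl mulrBr addrA subrK.
apply: rpredD; first by apply: aug_powSM; [apply: IH | rewrite gr_aug_map].
by rewrite -[p.+2]addn2; apply: aug_powM.
Qed.

End TrivialOnFirstPiece.

Section Factorization.

Variables (R : comPzRingType) (m : nat) (H : 'I_m -> groupType) (G : groupType).
Variable th : forall i, H i -> G.
Local Notation J := (@aug_pow R _).

Definition factor_prod (a : forall i, group_ring R (H i)) : group_ring R G :=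
  \prod_(i <- rev (enum 'I_m)) gr_map (@th i) (a i).

Hypothesis thM : forall i, {morph @th i : x y / (x * y)%g}.

Lemma factor_prod_of (g : forall i, H i) :
  factor_prod (fun i => gr_of R (g i)) =
  gr_of R (\prod_(i <- rev (enum 'I_m)) th (g i))%g.
Proof.
rewrite /factor_prod; elim: (rev _) => [|i s IH]; first by rewrite !big_nil.
by rewrite !big_cons IH gr_map_of gr_ofM.
Qed.

Lemma factor_prod_multilinear : multilinear factor_prod.
Proof.
apply: (multilinear_prod (F := fun i => gr_map (@th i))) => [i||i].
- exact: gr_map_linear.
- by rewrite rev_uniq enum_uniq.
by rewrite mem_rev mem_enum.
Qed.

Lemma factor_prod_pow a (d : 'I_m -> nat) : (forall i, a i \in J (d i)) ->
  factor_prod a \in J (\sum_i d i)%N.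
Proof.
move=> aJ; have -> : (\sum_i d i = \sum_(i <- rev (enum 'I_m)) d i)%N.
  by rewrite -big_enum; apply/perm_big; rewrite perm_sym perm_rev.
rewrite /factor_prod; elim: (rev _) => [|i s IH]; first by rewrite !big_nil.
rewrite !big_cons; apply: aug_powM IH.
exact/gr_map_pow.
Qed.

(** Each factor acts on the higher ones, and trivially on their first homology,
    which is [J / J^2] when the coefficients are in [R]. *)
Definition almost_direct := forall (i j : 'I_m) (h : H i), (i < j)%N ->
  exists al : H j -> H j, [/\ {morph al : x y / (x * y)%g},
    forall x, (th h * th x = th (al x) * th h)%g &
    forall x, gr_of R (al x) - gr_of R x \in J 2].

Definition factors_generate := forall Q : G -> Prop,
  Q 1%g -> (forall g h, Q g -> Q h -> Q (g * h)%g) ->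
  (forall i (h : H i), Q (th h)) -> forall g, Q g.

Hypotheses (th_comm : almost_direct) (th_gen : factors_generate).

(** The recursion on [s] lets a factor be changed without updating functions on
    indices. *)
Fixpoint factored (s : seq 'I_m) n (c : group_ring R G) : Prop :=
  if s is i :: s' then
    exists e n' a c', [/\ a \in @aug_pow R (H i) e, factored s' n' c',
      (n <= e + n')%N & c = gr_map (@th i) a * c']
  else n = 0%N /\ c = 1.

Lemma factored_leq s n n' c : (n <= n')%N -> factored s n' c -> factored s n c.
Proof.
case: s => [|i s] nn' /=; first by case=> E ->; split=> //; lia.
case=> [e [n1 [a [c' [aJ c'F n'e ->]]]]]; exists e, n1, a, c'.
by split=> //; apply: leq_trans n'e.
Qed.

(** Moving [h - 1] from the left to its factor: past a higher factor [a] it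
    leaves [al a - a], which is one degree deeper than [a], and at its own
    factor it is absorbed. *)
Lemma factored_left m' (i : 'I_m) (h : H i) n c : (m' <= m)%N -> (i < m')%N ->
  factored (desc m m') n c ->
  lspan (factored (desc m m') n.+1) ((gr_of R (th h) - 1) * c).
Proof.
move=> mm; move: m' mm n c; apply: desc_ind => // j IH n c ij.
rewrite descS => -[e [n' [a [c' [aJ c'F ne ->]]]]].
move: ij; rewrite ltnS leq_eqVlt => /predU1P[/val_inj ij|ij].
  move: ij a aJ => <- a aJ {j IH} in c'F *.
  apply: lspan_in; exists e.+1, n', ((gr_of R h - 1) * a), c'; split=> //.
    by apply: (@aug_powM _ _ 1 e) => //; apply/aug_pow1/gr_aug_ofB1.
  rewrite (gr_mapM (@thM i)) [in RHS]linearB /= gr_map_of (gr_map1 _ (@thM i)).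
  by rewrite mulrA.
have [al [alM al_comm al2]] := th_comm h ij.
have swap b : gr_of R (th h) * gr_map (@th j) b =
    gr_map (@th j) (gr_map al b) * gr_of R (th h).
  apply: (gr_linear_eq (f := fun b => gr_of R (th h) * gr_map (@th j) b)
    (h := fun b => gr_map (@th j) (gr_map al b) * gr_of R (th h))) => [t u v|t u v|g].
  - by rewrite gr_map_linear mulrDr gr_scalerAr.
  - by rewrite !gr_map_linear mulrDl gr_scalerAl.
  by rewrite !gr_map_of -!gr_ofM al_comm.
have -> : (gr_of R (th h) - 1) * (gr_map (@th j) a * c') =
    gr_map (@th j) (gr_map al a) * ((gr_of R (th h) - 1) * c') +
    gr_map (@th j) (gr_map al a - a) * c'.
  rewrite linearB /= !mulrBl !mul1r mulrBr !mulrA swap.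
  by rewrite addrA subrK.
apply: lspanD.
  apply: (lspan_image (V := group_ring R G) (W := group_ring R G)
    (f := fun z => gr_map (@th j) (gr_map al a) * z) _ _ (IH n' c' ij c'F))
    => [t u v|z zF].
    by rewrite mulrDr gr_scalerAr.
  apply: lspan_in; exists e, n'.+1, (gr_map al a), z; split=> //.
    exact: gr_map_pow.
  by rewrite addnS ltnS.
apply: lspan_in; exists e.+1, n', (gr_map al a - a), c'; split=> //.
exact: gr_map_trivial.
Qed.

Local Notation full := (desc m m).

Lemma lspan_factored_left (i : 'I_m) (h : H i) n c :
  lspan (factored full n) c -> lspan (factored full n.+1) ((gr_of R (th h) - 1) * c).
Proof.
move=> cS; apply: (lspan_image (V := group_ring R G) (W := group_ring R G)
  (f := fun z => (gr_of R (th h) - 1) * z) _ _ cS) => [t u v|z zF].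
  by rewrite mulrDr gr_scalerAr.
exact: factored_left.
Qed.

Lemma lspan_factored_mul (g : G) n c : lspan (factored full n) c ->
  lspan (factored full n) (gr_of R g * c) /\
  lspan (factored full n.+1) ((gr_of R g - 1) * c).
Proof.
have le z : lspan (factored full n.+1) z -> lspan (factored full n) z.
  by apply: lspan_least => y yF; apply/lspan_in/(factored_leq (leqnSn n)).
move: g c; apply: th_gen => [c cS|g g' IH IH' c cS|i h c cS].
- by rewrite gr_of1 mul1r subrr mul0r; split=> //; constructor.
- have [gc' gc'1] := IH' c cS; have [gg' gg'1] := IH _ gc'.
  split; first by rewrite gr_ofM -mulrA.
  have -> : (gr_of R (g * g')%g - 1) * c =
      (gr_of R g - 1) * (gr_of R g' * c) + (gr_of R g' - 1) * c.
    by rewrite gr_ofM !mulrBl !mul1r mulrA addrA subrK.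
  exact: lspanD.
have c1 := lspan_factored_left h cS; split=> //.
have -> : gr_of R (th h) * c = (gr_of R (th h) - 1) * c + c.
  by rewrite mulrBl mul1r subrK.
by apply: lspanD => //; apply: le.
Qed.

Lemma factored1 s : factored s 0 1.
Proof.
elim: s => // i s IH; exists 0%N, 0%N, 1, 1; split=> //.
by rewrite (gr_map1 _ (@thM i)) mulr1.
Qed.

Lemma aug_pow_factored n a : a \in J n -> lspan (factored full n) a.
Proof.
elim: n a => [|n IH] a.
  move=> _; rewrite (gr_decomp a); apply: lspan_sum => g _; apply: lspanZ.
  by rewrite -[gr_of R g]mulr1; apply/(lspan_factored_mul g _).1/lspan_in/factored1.
move=> /aug_powS_spanl; apply: lspan_least => _ [x [y [/aug_ker_span xS /IH yS ->]]].
apply: (lspan_image (V := group_ring R G) (W := group_ring R G)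
  (f := fun z => z * y) _ _ xS) => [t u v|_ [g ->]].
  by rewrite mulrDl gr_scalerAl.
exact: (lspan_factored_mul g yS).2.
Qed.

Lemma factored_prod s n c : uniq s -> factored s n c ->
  exists (d : 'I_m -> nat) (a : forall i, group_ring R (H i)),
    [/\ forall i, a i \in J (d i), (n <= \sum_(i <- s) d i)%N &
        c = \prod_(i <- s) gr_map (@th i) (a i)].
Proof.
elim: s n c => [|i s IH] n c.
  move=> _ [-> ->]; exists (fun=> 0%N), (fun i => 1); rewrite !big_nil.
  by split.
move=> /= /andP[is_ s_uniq] [e [n' [b [c' [bJ c'F ne ->]]]]].
have [d [a [aJ n'd c'E]]] := IH _ _ s_uniq c'F.
exists (fun j => if j == i then e else d j), (dfwith a b).
have out j : j \in s -> (i != j) by apply: contraTneq => <-.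
split=> [j||].
- by case: dfwithP => [|j' /negPf ij]; rewrite ?eqxx // eq_sym ij.
- rewrite big_cons eqxx (leq_trans ne) // leq_add2l (leq_trans n'd) //.
  rewrite big_seq [X in (_ <= X)%N]big_seq; apply: leq_sum => j /out ij.
  by rewrite eq_sym (negPf ij).
rewrite big_cons dfwith_in c'E; congr (_ * _); apply: eq_big_seq => j /out ij.
by rewrite dfwith_out.
Qed.

(** The filtration by augmentation powers does not see the conjugations by which
    an almost direct product differs from the direct product. *)
Lemma aug_pow_factor_prod n a : a \in J n ->
  lspan (fun c => exists d b, [/\ forall i, b i \in J (d i),
    (n <= \sum_i d i)%N & c = factor_prod b]) a.
Proof.
move=> /aug_pow_factored; apply: lspan_least => c /(factored_prod (desc_uniq _ _)).
case=> d [b [bJ nd cE]]; apply: lspan_in; exists d, b; split=> //.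
  rewrite -big_enum; move: nd; rewrite desc_full.
  by rewrite (perm_big (enum 'I_m)) ?perm_rev // perm_sym.
by rewrite /factor_prod -desc_full.
Qed.

End Factorization.

(** * Pure braids as an almost direct product *)

Section TrivialModSquare.

Variables (R : comPzRingType) (H : groupType).
Local Notation J := (@aug_pow R H).

(** A commutator of [x] and [g] in the group ring is one of [x - 1] and
    [g - 1]. *)
Lemma conjg_trivial (x g : H) : gr_of R (x ^ g)%g - gr_of R x \in J 2.
Proof.
have -> : gr_of R (x ^ g)%g - gr_of R x = gr_of R g^-1%g *
    ((gr_of R x - 1) * (gr_of R g - 1) - (gr_of R g - 1) * (gr_of R x - 1)).
  have -> : gr_of R x = gr_of R g^-1%g * (gr_of R g * gr_of R x).
    by rewrite -!gr_ofM mulKg.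
  rewrite conjgE !gr_ofM -mulrBr; congr (_ * _).
  rewrite mulrA -(gr_ofM _ g^-1%g) mulVg gr_of1 mul1r.
  move: (gr_of R x) (gr_of R g) => a b; rewrite !(mulrBl, mulrBr) !mulr1 !mul1r.
  have -> : a * b - a - (b - 1) = a * b - (a + b - 1) by rewrite -addrA -opprD addrA.
  have -> : b * a - b - (a - 1) = b * a - (a + b - 1).
    by rewrite -addrA -opprD addrA (addrC b).
  by rewrite [- (b * a - _)]opprB addrA subrK.
rewrite -[2%N]add0n; apply: aug_powM => //; apply: rpredB;
  by apply: (@aug_powM _ _ 1 1); apply/aug_pow1/gr_aug_ofB1.
Qed.

Lemma gr_of_trivial (I : Type) (x : I -> H) (al : H -> H) :
  {morph al : g h / (g * h)%g} -> (forall j, exists g, al (x j) = (x j ^ g)%g) ->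
  forall h, h \in generated x -> gr_of R (al h) - gr_of R h \in J 2.
Proof.
move=> alM alx; have al1 : al 1%g = 1%g by apply: (mulgI (al 1%g)); rewrite -alM !mulg1.
apply: generated_ind => [|g h gJ hJ|g gJ|j].
- by rewrite al1 subrr rpred0.
- have -> : gr_of R (al (g * h)%g) - gr_of R (g * h)%g =
      (gr_of R (al g) - gr_of R g) * gr_of R (al h) +
      gr_of R g * (gr_of R (al h) - gr_of R h).
    by rewrite alM !gr_ofM mulrBl mulrBr addrA subrK.
  by apply: rpredD; [apply: (@aug_powM _ _ 2 0) | apply: (@aug_powM _ _ 0 2)].
- have -> : gr_of R (al g^-1%g) - gr_of R g^-1%g =
      - (gr_of R (al g^-1%g) * (gr_of R (al g) - gr_of R g) * gr_of R g^-1%g).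
    rewrite mulrBr mulrBl -!gr_ofM -alM mulVg al1 mul1g.
    by rewrite mulgK opprB.
  rewrite rpredN; apply: (@aug_powM _ _ 2 0) => //.
  exact: (@aug_powM _ _ 0 2).
by have [g ->] := alx j; apply: conjg_trivial.
Qed.

End TrivialModSquare.

Section FactorCongruence.

Variables (R : comPzRingType) (m : nat) (H : 'I_m -> groupType) (G : groupType).
Variable th : forall i, H i -> G.
Hypothesis thM : forall i, {morph @th i : x y / (x * y)%g}.

Lemma factor_prod_congr (a b : forall i, group_ring R (H i)) (d : 'I_m -> nat) :
  (forall i, a i \in aug_pow (d i)) -> (forall i, b i \in aug_pow (d i)) ->
  (forall i, a i - b i \in aug_pow (d i).+1) ->
  factor_prod th a - factor_prod th b \in aug_pow (\sum_i d i).+1.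
Proof.
move=> aJ bJ abJ; have -> : (\sum_i d i = \sum_(i <- rev (enum 'I_m)) d i)%N.
  by rewrite -big_enum; apply/perm_big; rewrite perm_sym perm_rev.
rewrite /factor_prod; elim: (rev _) => [|i s IH].
  by rewrite !big_nil subrr rpred0.
have prodJ : \prod_(j <- s) gr_map (@th j) (b j) \in aug_pow (\sum_(j <- s) d j).
  elim: (s) => [|j r IHr]; first by rewrite !big_nil.
  by rewrite !big_cons; apply: aug_powM IHr; apply: gr_map_pow.
rewrite !big_cons.
set A := gr_map _ (a i); set B := gr_map _ (b i).
set X := \prod_(_ <- _) _; set Y := \prod_(_ <- _) _.
have -> : A * X - B * Y = A * (X - Y) + (A - B) * Y.
  by rewrite mulrBr mulrBl addrA subrK.
apply: rpredD.
  by rewrite -addnS; apply: aug_powM IH; apply: (gr_map_pow (@thM i) (aJ i)).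
have -> : A - B = gr_map (@th i) (a i - b i) by rewrite linearB.
by apply: (@aug_powM _ _ (d i).+1) prodJ; apply: (gr_map_pow (@thM i) (abJ i)).
Qed.

End FactorCongruence.

Section DirectProduct.

Local Open Scope group_scope.

Variables (m : nat) (H : 'I_m -> groupType).

Lemma dir_injM i : {morph @dir_inj _ H i : x y / x * y}.
Proof.
move=> x y; apply: functional_extensionality_dep => j.
rewrite -[RHS]/(dir_inj x j * dir_inj y j) /dir_inj.
case: (eqVneq i j) => [ij|ij]; last by rewrite !dfwith_out // mulg1.
by move: ij => <-; rewrite !dfwith_in.
Qed.

Lemma prod_dir_prodE (s : seq 'I_m) (F : 'I_m -> dir_prod H) j :
  (\prod_(i <- s) F i) j = \prod_(i <- s) F i j.
Proof.
elim: s => [|i s IH]; first by rewrite !big_nil.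
by rewrite !big_cons -IH.
Qed.

Lemma dir_prod_decomp (g : dir_prod H) :
  g = \prod_(i <- rev (enum 'I_m)) dir_inj (g i).
Proof.
apply: functional_extensionality_dep => j; rewrite prod_dir_prodE.
have : j \in rev (enum 'I_m) by rewrite mem_rev mem_enum.
have : uniq (rev (enum 'I_m)) by rewrite rev_uniq enum_uniq.
elim: (rev _) => // i s IH /= /andP[is_ s_uniq]; rewrite big_cons inE.
have [->|ij] := eqVneq j i => /= [_|js].
  rewrite /dir_inj dfwith_in big1_seq ?mulg1 // => l /= ls.
  by rewrite dfwith_out //; apply: contraNneq is_ => <-.
by rewrite -IH // /dir_inj dfwith_out ?mul1g // eq_sym.
Qed.

Lemma dir_inj_almost_direct (R : comPzRingType) : almost_direct R (@dir_inj _ H).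
Proof.
move=> i j h ij; exists id; split=> // [x|x]; last by rewrite subrr rpred0.
apply: functional_extensionality_dep => l.
rewrite -[LHS]/(dir_inj h l * dir_inj x l) -[RHS]/(dir_inj x l * dir_inj h l) /dir_inj.
have [il|il] := eqVneq i l; last by rewrite [dfwith _ h _]dfwith_out // mul1g mulg1.
rewrite [dfwith _ x _]dfwith_out ?mul1g ?mulg1 //.
by apply/eqP => jl; move: ij; rewrite jl il ltnn.
Qed.

Lemma dir_inj_generate : factors_generate (@dir_inj _ H).
Proof.
move=> Q Q1 QM Qinj g; rewrite (dir_prod_decomp g).
by elim/big_ind: _ => // i _; apply: Qinj.
Qed.

End DirectProduct.

Section PureBraidFactors.

Local Open Scope group_scope.

Variables (R : comPzRingType) (k : nat).
Local Notation s := (@nat_sigma k).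

Definition strand_incl (i : 'I_k.-1) (g : strand_group i) : pure_braid k :=
  gen_subgroup_val g.

Lemma strand_inclM i : {morph @strand_incl i : x y / x * y}.
Proof. by []. Qed.

Lemma strand_incl_generate : factors_generate strand_incl.
Proof.
move=> Q Q1 QM Qinj b; rewrite -[b]combK /comb_eval.
by elim/big_ind: _ => // i _; apply: Qinj.
Qed.

(** A pure braid on fewer strands conjugates each link into a conjugate of the
    same link. *)
Lemma strand_incl_almost_direct : almost_direct R strand_incl.
Proof.
move=> i j h ij.
have [w wi hE] : exists2 w, letters_below j w & strand_val h^-1 = word_eval s w.
  have [w wi wE] := strand_word h^-1.
  by exists w => //; apply: letters_below_leq wi.
have jk := ltn_ord j.
have /choice[al alE] : forall x : strand_group j, exists y : strand_group j,
    strand_val y = strand_val x ^ word_eval s w.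
  move=> x; apply: generated_strand_val.
  exact: (link_family_normal (nat_sigma_relations k) wi jk (strand_val_generated x)).
have alM : {morph al : x y / x * y}.
  by move=> x y; apply: strand_val_inj; rewrite !(alE, strand_valM) conjMg.
exists al; split=> // [x|x].
  apply: val_inj; rewrite /= -!/(strand_val _) alE -hE conjgE.
  rewrite (_ : strand_val h^-1 = (strand_val h)^-1) // invgK.
  by rewrite !mulgA mulgVK.
apply: (@gr_of_trivial R (strand_group j) _ (subgroup_gen (@strand_gen k j))
  al alM); last first.
  by have [u ->] := strand_val_word x; apply/asboolP; exists u.
move=> l; have lk : (l < k)%N by have := ltn_ord l; lia.
have [l' l'E [g gF gE]] := link_conj_word (nat_sigma_relations k) l wi jk.
have l'l : l' = l.
  apply: val_inj; rewrite /= l'E.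
  have /eqP hP : braid_perm (strand_val h^-1) == 1.
    exact: (valP (gen_subgroup_val h^-1)).
  have := word_permE (Ordinal lk) (letters_below_leq (ltnW jk) wi).
  by rewrite -hE hP perm1.
have [y yE] := generated_strand_val gF; exists y; apply: strand_val_inj.
have lE : strand_val (subgroup_gen (@strand_gen k j) l) = link_family s l.
  by rewrite /strand_val /= strand_braidE.
by rewrite alE lE gE l'l -lE -yE.
Qed.

End PureBraidFactors.

(** * The leading term of the Magnus expansion of braids *)

Lemma sum_leq_ex_ltn m (d e : 'I_m -> nat) j : d j != e j ->
  (\sum_i d i <= \sum_i e i)%N -> exists i, (d i < e i)%N.
Proof.
move=> dej de; apply/existsP; apply: contraNT dej => /existsPn ed.
have E : (\sum_i e i <= \sum_i d i ?= iff [forall i, e i == d i])%N.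
  by apply: leqif_sum => i _; apply: leqif_eq; rewrite leqNgt ed.
have /forallP/(_ j) : [forall i, e i == d i] by rewrite -(geq_leqif E).
by rewrite eq_sym.
Qed.

Lemma sum_ltn_ex_ltn m (d e : 'I_m -> nat) :
  (\sum_i d i < \sum_i e i)%N -> exists i, (d i < e i)%N.
Proof.
move=> de; apply/existsP; apply: contraLR de => /existsPn ed.
by rewrite -leqNgt; apply: leq_sum => i _; rewrite leqNgt.
Qed.

Section MagnusExpansion.

Variables (R : comPzRingType) (k : nat).
Local Notation P := (pure_braid k).
Local Notation Pi := (strand_prod k).
Local Notation RP := (group_ring R P).
Local Notation factors := (forall i : 'I_k.-1, group_ring R (strand_group i)).
Local Notation prodP := (factor_prod (@strand_incl k)).
Local Notation prodPi := (factor_prod (@dir_inj _ (@strand_group k))).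

Definition comb_eval_ext : group_ring R Pi -> RP := gr_map (@comb_eval k).

Lemma comb_ext_linear : linear (@comb_ext R k).
Proof. exact: lin_ext_linear. Qed.

Lemma comb_ext_of b : comb_ext (gr_of R b) = gr_of R (comb b : Pi).
Proof. exact: lin_ext_of. Qed.

Lemma comb_extK : cancel (@comb_ext R k) comb_eval_ext.
Proof.
apply: (gr_linear_eq (f := fun a : RP => comb_eval_ext (comb_ext a)) (h := id))
  => [t a b|//|g]; first by rewrite comb_ext_linear /comb_eval_ext gr_map_linear.
by rewrite comb_ext_of /comb_eval_ext gr_map_of combK.
Qed.

Lemma comb_ext_factor (a : factors) : comb_ext (prodP a) = prodPi a.
Proof.
apply: (multilinear_eq (Phi := @comb_ext R k \o prodP)) a => [||g].
- apply: multilinear_linear; first exact: comb_ext_linear.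
  exact: factor_prod_multilinear.
- exact: factor_prod_multilinear.
rewrite /= !factor_prod_of comb_ext_of.
by rewrite (comb_evalK (g : Pi)) -dir_prod_decomp.
Qed.

Lemma comb_eval_ext_factor (a : factors) : comb_eval_ext (prodPi a) = prodP a.
Proof. by rewrite -comb_ext_factor comb_extK. Qed.

Let prodP_pow (a : factors) (d : 'I_k.-1 -> nat) n :
  (forall i, a i \in aug_pow (d i)) -> (n <= \sum_i d i)%N -> prodP a \in aug_pow n.
Proof. by move=> aJ nd; apply: aug_pow_anti nd _; apply: factor_prod_pow. Qed.

Lemma comb_ext_pow n a : a \in @aug_pow R P n -> comb_ext a \in @aug_pow R Pi n.
Proof.
move=> /(aug_pow_factor_prod (@strand_inclM k) (@strand_incl_almost_direct R k)
  (@strand_incl_generate k)).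
elim=> [|t _ y [d [b [bJ nd ->]]] _ IH]; first by rewrite /comb_ext linear0 rpred0.
rewrite comb_ext_linear comb_ext_factor; apply: rpredD => //; apply: rpredZ.
by apply: aug_pow_anti nd _; apply: factor_prod_pow => //; apply: dir_injM.
Qed.

Lemma comb_eval_ext_pow n a :
  a \in @aug_pow R Pi n -> comb_eval_ext a \in @aug_pow R P n.
Proof.
move=> /(aug_pow_factor_prod (@dir_injM _ _) (@dir_inj_almost_direct _ _ R)
  (@dir_inj_generate _ _)).
elim=> [|t _ y [d [b [bJ nd ->]]] _ IH]; first by rewrite /comb_eval_ext linear0 rpred0.
rewrite /comb_eval_ext gr_map_linear -/comb_eval_ext comb_eval_ext_factor.
by apply: rpredD => //; apply: rpredZ; apply: prodP_pow nd.
Qed.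

(** Both the combing map and its inverse preserve the augmentation powers. *)
Lemma comb_graded_inj : injective (@comb_graded R k).
Proof.
move=> u w E; apply: functional_extensionality_dep => n.
rewrite -[u n]piece_reprK -[w n]piece_reprK.
apply/piece_class_eqP; [exact: piece_repr_pow | exact: piece_repr_pow |].
have := congr1 (fun t => t n) E; rewrite /comb_graded.
move=> /piece_class_eqP; rewrite !comb_ext_pow ?piece_repr_pow // => /(_ isT isT).
move=> /comb_eval_ext_pow.
have -> : comb_ext (piece_repr (u n)) - comb_ext (piece_repr (w n)) =
    comb_ext (piece_repr (u n) - piece_repr (w n)) by rewrite /comb_ext linearB.
by rewrite comb_extK.
Qed.

Definition strand_magnus (i : 'I_k.-1) :=
  free_magnus (R := R) (subgroup_gen (@strand_gen k i)).

Lemma strand_magnus_spec i :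
  magnus_spec (subgroup_gen (@strand_gen k i)) (@strand_magnus i).
Proof.
have [phi phiM [phix _]] := strand_hom (@free_gen 'I_i.+1).
have [F F_spec] := magnus_spec_exists R phiM phix.
by rewrite /strand_magnus /free_magnus; case: xgetP => [f _ //|/(_ F)].
Qed.

Definition strand_part (i : 'I_k.-1) n : group_ring R (strand_group i) ->
    group_ring R (strand_group i) :=
  magnus_part (subgroup_gen (@strand_gen k i)) (@strand_magnus i) n.

(** The component of degree [n] of the expansion of a combed braid, lifted from
    the graded module of the direct product to the group ring of pure braids:
    there it can be added up and compared with the element that is expanded. *)
Definition braid_part n (a : factors) : RP :=
  \sum_(d : {ffun 'I_k.-1 -> 'I_n.+1} | (\sum_i d i == n)%N)
    prodP (fun i => strand_part (d i) (a i)).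

Definition braid_part_ext n : RP -> RP :=
  lin_ext (fun b => braid_part n (fun i => gr_of R (comb b i))).

Lemma strand_part_linear i n : linear (@strand_part i n).
Proof. exact/magnus_part_linear/strand_magnus_spec. Qed.

Lemma strand_part_pow i n a : @strand_part i n a \in aug_pow n.
Proof. exact: magnus_part_pow. Qed.

Lemma braid_part_multilinear n : multilinear (braid_part n).
Proof.
apply: multilinear_sum => d.
apply: (multilinear_prod
  (F := fun i => gr_map (@strand_incl k i) \o strand_part (d i))).
- by move=> i t x y; rewrite /= strand_part_linear gr_map_linear.
- by rewrite rev_uniq enum_uniq.
by move=> i; rewrite mem_rev mem_enum.
Qed.

Lemma braid_part_pow n a : braid_part n a \in aug_pow n.
Proof.
apply: rpred_sum => d /eqP dn.
apply: (prodP_pow (d := fun i => d i)); last by rewrite dn.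
by move=> i; apply: strand_part_pow.
Qed.

Lemma braid_part_ext_linear n : linear (braid_part_ext n).
Proof. exact: lin_ext_linear. Qed.

Lemma braid_part_ext_of n b :
  braid_part_ext n (gr_of R b) = braid_part n (fun i => gr_of R (comb b i)).
Proof. exact: lin_ext_of. Qed.

Lemma braid_part_ext_pow n a : braid_part_ext n a \in aug_pow n.
Proof.
rewrite (gr_decomp a) /braid_part_ext linear_sum; apply: rpred_sum => b _.
rewrite linearZ; apply: rpredZ; rewrite [X in X \in _]lin_ext_of.
exact: braid_part_pow.
Qed.

Lemma braid_part_ext_factor n (a : factors) :
  braid_part_ext n (prodP a) = braid_part n a.
Proof.
apply: (multilinear_eq (Phi := braid_part_ext n \o prodP)) a => [||g].
- apply: multilinear_linear; first exact: braid_part_ext_linear.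
  exact: factor_prod_multilinear.
- exact: braid_part_multilinear.
by rewrite /= factor_prod_of braid_part_ext_of (comb_evalK (g : Pi)).
Qed.

Lemma comb_braid_part n (a : factors) : comb_ext (braid_part n a) =
  \sum_(d : {ffun 'I_k.-1 -> 'I_n.+1} | (\sum_i d i == n)%N)
    prodPi (fun i => strand_part (d i) (a i)).
Proof.
rewrite /braid_part /comb_ext linear_sum; apply: eq_bigr => d _.
exact: comb_ext_factor.
Qed.

(** The representatives chosen in the definition of the expansion only matter
    modulo the next augmentation power, which the combing map respects. *)
Lemma magnus_braidE b n :
  magnus_braid R b n = piece_class n (braid_part n (fun i => gr_of R (comb b i))).
Proof.
rewrite /magnus_braid; set T := graded_tensor _.
set a : factors := fun i => gr_of R (comb b i).
pose u : graded R P := fun n => piece_class n (braid_part n a).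
suff uT : comb_graded u = T.
  rewrite /comb_graded_inv; case: xgetP => [w _ /= wT|/(_ u)//].
  by have -> : w = u by apply: comb_graded_inj; rewrite wT.
apply: functional_extensionality_dep => {}n; rewrite /comb_graded /T /graded_tensor.
transitivity (piece_class n (comb_ext (braid_part n a))).
  have aJ := braid_part_pow n a.
  apply/piece_class_eqP; rewrite ?comb_ext_pow ?piece_repr_pow //.
  have -> : comb_ext (piece_repr (u n)) - comb_ext (braid_part n a) =
      comb_ext (piece_repr (u n) - braid_part n a) by rewrite /comb_ext linearB.
  apply: comb_ext_pow; apply/piece_class_eqP => //; first exact: piece_repr_pow.
  by rewrite piece_reprK.
rewrite comb_braid_part.
have dJ (d : 'I_k.-1 -> nat) (c : factors) : (forall i, c i \in aug_pow (d i)) ->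
    (\sum_i d i == n)%N -> prodPi c \in aug_pow n.
  by move=> cJ /eqP <-; apply: factor_prod_pow => //; apply: dir_injM.
apply/piece_class_eqP.
- by apply: rpred_sum => d; apply: dJ => i; apply: strand_part_pow.
- by apply: rpred_sum => d; apply: dJ => i; apply: piece_repr_pow.
rewrite -sumrB; apply: rpred_sum => d /eqP dn.
apply: (@aug_pow_anti _ _ _ (\sum_i d i).+1); first by rewrite dn.
apply: factor_prod_congr => [i|i|i|i].
- exact: dir_injM.
- exact: strand_part_pow.
- exact: piece_repr_pow.
apply/piece_class_eqP; [exact: strand_part_pow | exact: piece_repr_pow |].
by rewrite piece_reprK.
Qed.

Lemma magnus_linear : linear (@magnus R k).
Proof. exact: lin_ext_linear. Qed.

Lemma magnusE (a : RP) n : magnus a n = piece_class n (braid_part_ext n a).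
Proof.
apply: (gr_linear_eq (V := gr_piece R P n) (f := fun a => magnus a n)
  (h := fun a => piece_class n (braid_part_ext n a))) => [t x y|t x y|b].
- by rewrite magnus_linear.
- have xJ := braid_part_ext_pow n x; have yJ := braid_part_ext_pow n y.
  by rewrite braid_part_ext_linear piece_classD ?rpredZ // piece_classZ.
by rewrite /magnus lin_ext_of magnus_braidE braid_part_ext_of.
Qed.

Lemma prodP0 (a : factors) i : a i = 0 -> prodP a = 0.
Proof.
move=> ai; rewrite /factor_prod; have : i \in rev (enum 'I_k.-1).
  by rewrite mem_rev mem_enum.
elim: (rev _) => // j s IH; rewrite inE big_cons => /predU1P[<-|/IH ->].
  by rewrite ai linear0 mul0r.
by rewrite mulr0.
Qed.

(** When the total degree is too small, one of the factors is expanded below its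
    order. *)
Lemma braid_part_small n (a : factors) (e : 'I_k.-1 -> nat) :
  (forall i, a i \in aug_pow (e i)) -> (n < \sum_i e i)%N -> braid_part n a = 0.
Proof.
move=> aJ ne; apply: big1 => d /eqP dn.
have [i di] : exists i, (d i < e i)%N by apply: sum_ltn_ex_ltn; rewrite dn.
apply: (prodP0 (i := i)).
exact: (magnus_part_order (strand_magnus_spec i) (@strand_val_word _ i) (aJ i) di).
Qed.

(** Among the degrees [d] of total degree [n], every [d] other than [e] is
    below [e] at some factor, so that only the term of [e] survives. *)
Lemma braid_part_lead n (a : factors) (e : 'I_k.-1 -> nat) :
  (forall i, a i \in aug_pow (e i)) -> n = (\sum_i e i)%N ->
  braid_part n a - prodP a \in aug_pow n.+1.
Proof.
move=> aJ ne; have en i : (e i <= n)%N by rewrite ne (bigD1 i) //= leq_addr.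
pose d0 : {ffun 'I_k.-1 -> 'I_n.+1} := [ffun i => inord (e i)].
have d0E i : d0 i = e i :> nat by rewrite ffunE inordK // ltnS.
have d0n : (\sum_i d0 i == n)%N.
  by apply/eqP; rewrite [RHS]ne; apply: eq_bigr => i _; apply: d0E.
rewrite /braid_part (bigD1 d0) // big1 => [|d /andP[/eqP dn dd0]].
  rewrite [X in X - _]addr0.
  apply: (@aug_pow_anti _ _ _ (\sum_i e i).+1); first by rewrite -ne.
  apply: (factor_prod_congr (@strand_inclM k)) => [i|//|i].
    by rewrite -d0E; apply: strand_part_pow.
  rewrite -opprB rpredN -d0E; apply: magnus_part_id; last by rewrite d0E; apply: aJ.
    exact: strand_magnus_spec.
  exact: strand_val_word.
have [j dj] : exists j, d j != e j :> nat.
  apply/existsP; apply: contraNT dd0 => /existsPn de.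
  apply/eqP/ffunP => j; apply/val_inj; rewrite /= d0E.
  by apply/eqP; rewrite -[_ == _]negbK de.
have [i di] := sum_leq_ex_ltn (d := fun i => d i) dj (eq_leq (etrans dn ne)).
apply: (prodP0 (i := i)).
exact: (magnus_part_order (strand_magnus_spec i) (@strand_val_word _ i) (aJ i) di).
Qed.

Lemma braid_part_ext_lead N a : a \in aug_pow N ->
  (forall n, (n < N)%N -> braid_part_ext n a = 0) /\
  braid_part_ext N a - a \in aug_pow N.+1.
Proof.
move=> /(aug_pow_factor_prod (@strand_inclM k) (@strand_incl_almost_direct R k)
  (@strand_incl_generate k)).
elim=> [|t _ y [e [b [bJ Ne ->]]] _ [IHlt IHeq]].
  by split=> [n _|]; rewrite /braid_part_ext linear0 ?subr0 ?rpred0.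
split=> [n nN|].
  rewrite braid_part_ext_linear IHlt // addr0 braid_part_ext_factor.
  by rewrite (braid_part_small bJ) ?scaler0 //; apply: leq_trans Ne.
rewrite braid_part_ext_linear opprD addrACA -scalerBr rpredD // rpredZ //.
rewrite braid_part_ext_factor; move: Ne; rewrite leq_eqVlt => /predU1P[Ne|Ne].
  exact: braid_part_lead bJ Ne.
by rewrite (braid_part_small bJ) // sub0r rpredN; apply: prodP_pow Ne.
Qed.

Lemma magnus_small N n a : a \in aug_pow N -> (n < N)%N -> magnus (a : RP) n = 0.
Proof.
move=> /braid_part_ext_lead[lt _] nN; rewrite magnusE lt //.
by rewrite piece_class0 // rpred0.
Qed.

Lemma magnus_lead n a : a \in aug_pow n -> magnus (a : RP) n = piece_class n a.
Proof.
move=> aJ; have [_ lead] := braid_part_ext_lead aJ; rewrite magnusE.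
by apply/piece_class_eqP => //; apply: braid_part_ext_pow.
Qed.

Lemma magnus_ker n (a : RP) :
  (forall m, (m < n)%N -> magnus a m = 0) -> a \in aug_pow n.
Proof.
elim: n => // n IH a0; have aJ : a \in aug_pow n.
  by apply: IH => m mn; apply/a0/ltnW.
have := a0 n (ltnSn n); rewrite magnus_lead // => an0.
rewrite -[a]subr0; apply/piece_class_eqP; rewrite ?rpred0 //.
by rewrite an0 piece_class0 // rpred0.
Qed.

(** Adding a representative of the difference in degree [n] corrects that degree
    without disturbing the lower ones. *)
Lemma magnus_dense (u : graded R P) n :
  exists a : RP, forall m, (m < n)%N -> magnus a m = u m.
Proof.
elim: n => [|n [a aE]]; first by exists 0.
pose r := piece_repr (u n - magnus a n).
have rJ : r \in aug_pow n by apply: piece_repr_pow.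
exists (1 *: a + r) => m mn; rewrite magnus_linear.
transitivity (1 *: magnus a m + magnus r m); first by [].
rewrite scale1r; move: mn; rewrite ltnS leq_eqVlt; case/predU1P => [->|mn].
  by rewrite (magnus_lead rJ) piece_reprK addrC subrK.
by rewrite (magnus_small rJ mn) addr0 aE.
Qed.

End MagnusExpansion.

(** * Universality *)

Section UniversalInvariant.

Variables (R : comPzRingType) (k : nat).
Local Notation P := (pure_braid k).
Local Notation RP := (group_ring R P).

(** The expansion truncated in degrees below [n] identifies the quotient of the
    group ring by [J^n] with the truncated graded module, so that [f] descends
    to the latter; continuity forces the value on every series, since the
    expansions are dense. *)
Lemma magnus_universal (f : RP -> R^o) n : linear f ->
  (forall a, a \in aug_pow n -> f a = 0) ->
  exists! g : graded R P -> R^o,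
    [/\ linear g, graded_continuous g & g \o @magnus R k = f].
Proof.
move=> f_lin f0.
have fB a b : f (a - b) = f a - f b.
  by rewrite addrC -scaleN1r f_lin scaleN1r addrC.
have magnusB (a b : RP) : magnus (a - b) = magnus a - magnus b.
  by rewrite addrC -scaleN1r magnus_linear scaleN1r addrC.
have f_eq (a b : RP) : (forall m, (m < n)%N -> magnus a m = magnus b m) -> f a = f b.
  move=> ab; apply/eqP; rewrite -subr_eq0 -fB; apply/eqP/f0/magnus_ker => m mn.
  by rewrite magnusB -[LHS]/(magnus a m - magnus b m) ab // subrr.
have /choice[lift liftE] : forall u : graded R P, exists a : RP,
    forall m, (m < n)%N -> magnus a m = u m by move=> u; apply: magnus_dense.
exists (f \o lift); split; first split.
- move=> t u w /=; rewrite -f_lin; apply: f_eq => m mn.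
  by rewrite liftE // magnus_linear -[RHS]/(t *: magnus _ m + magnus _ m) !liftE.
- exists n => u u0 /=; apply/f0/magnus_ker => m mn.
  by rewrite liftE // u0 // ltnW.
- by apply/funext => a /=; apply: f_eq => m mn; rewrite liftE.
move=> g [g_lin [N gN] gf]; apply/funext => u.
have [a aE] := magnus_dense u (maxn n N.+1).
have gu : g u = g (magnus a).
  apply/eqP; rewrite -subr_eq0; apply/eqP.
  transitivity (g (u - magnus a)).
    by rewrite addrC [in RHS]addrC -[in RHS]scaleN1r g_lin scaleN1r.
  apply: gN => m mN; rewrite -[LHS]/(u m - magnus a m) aE ?subrr //.
  by rewrite leq_max [(m < N.+1)%N]mN orbT.
rewrite gu -[g (magnus a)]/((g \o @magnus R k) a) gf /=.
by apply: f_eq => m mn; rewrite liftE // aE // leq_max mn.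
Qed.

End UniversalInvariant.

Theorem theorem5 (R : comPzRingType) (k : nat) (hk : (1 <= k)%N)
    (v : pure_braid k -> R) (hv : finite_type v) :
  exists! vhat : graded R (pure_braid k) -> R^o,
    [/\ linear vhat, graded_continuous vhat &
        vhat \o @magnus R k = lin_ext (v : pure_braid k -> R^o)].
Proof.
have [n vn] := hv.
apply: (magnus_universal (n := n.+1)); first exact: lin_ext_linear.
by move=> a; apply: of_type_aug_pow.
Qed.
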